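(* Let $n\ge1$, let $\mathbb F$ be a field of characteristic different from $2$, and let $q\in\mathbb F$ be nonzero with $[k]\neq0$ for $1\le k\le n$. Suppose that $\mathbb F$ contains square roots $\sqrt{-1}$ and $\sqrt{[2m+1]}$ for all integers $m$ with $0\le m\le\frac{n-1}2$. Then the alternating Hecke algebra $\mathcal H_{\mathbb F,q}(\mathfrak A_n)$ is split semisimple.
   Context: For $k\ge0$, $[k]=q+q^3+\dots+q^{2k-1}$. $\mathfrak S_n$ is the symmetric group with Coxeter generators $s_i=(i,i+1)$ and Coxeter length $\ell$. The Hecke algebra $\mathcal H_{\mathbb F,q}(\mathfrak S_n)$ is the unital associative $\mathbb F$-algebra with generators $T_1,\dots,T_{n-1}$ and relations $(T_i-q)(T_i+q^{-1})=0$, $T_iT_j=T_jT_i$ for $|i-j|>1$, $T_iT_{i+1}T_i=T_{i+1}T_iT_{i+1}$. For a reduced expression $w=s_{i_1}\cdots s_{i_k}$ put $T_w=T_{i_1}\cdots T_{i_k}$. Let $\#$ be the $\mathbb F$-algebra automorphism of $\mathcal H_{\mathbb F,q}(\mathfrak S_n)$ with $T_w^\#=(-1)^{\ell(w)}T_{w^{-1}}^{-1}$ for all $w\in\mathfrak S_n$. The alternating Hecke algebra is the fixed-point subalgebra $\mathcal H_{\mathbb F,q}(\mathfrak A_n)=\{a\in\mathcal H_{\mathbb F,q}(\mathfrak S_n):a^\#=a\}$. *)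

(* Defs.v *)
From HB Require Import structures.
From mathcomp Require Import all_boot all_order all_fingroup all_algebra.
From mathcomp Require Import generic_quotient boolp.

Set Implicit Arguments.
Unset Strict Implicit.
Unset Printing Implicit Defensive.

Import GRing.Theory.
Local Open Scope ring_scope.

Definition qint (F : fieldType) (q : F) (k : nat) : F :=
  \sum_(i < k) q ^+ (2 * i).+1.

(* The generators s_1, ..., s_{n-1} are indexed from 0 by 'I_n.-1, and they
   act on {0, ..., n-1}: the index i stands for the transposition (i, i+1). *)

Fact adj_lt0 (n : nat) (i : 'I_n.-1) : (i < n)%N.
Proof. by case: n i => [[]//|n] i; apply: ltnW; rewrite ltnS. Qed.

Fact adj_lt1 (n : nat) (i : 'I_n.-1) : (i.+1 < n)%N.
Proof. by case: n i => [[]//|n] i; rewrite ltnS. Qed.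

Definition adj (n : nat) (i : 'I_n.-1) : 'S_n :=
  tperm (Ordinal (adj_lt0 i)) (Ordinal (adj_lt1 i)).

(* Products in 'S_n compose from left to right.  Reading them from right to
   left exchanges w and w^-1, which preserves length. *)
Definition word_perm (n : nat) (s : seq 'I_n.-1) : 'S_n :=
  (\prod_(i <- s) adj i)%g.

Lemma word_permP (n : nat) (w : 'S_n) : exists s, word_perm s = w.
Proof.
case: n w => [|n] w.
  by exists [::]; apply/permP => -[].
pose A := [set @adj n.+1 i | i : 'I_n].
have adjA i : adj i \in <<A>>%g by apply/mem_gen/imset_f.
have t0 (k : nat) (lt_kn : (k < n.+1)%N) :
    tperm ord0 (Ordinal lt_kn) \in <<A>>%g.
  elim: k lt_kn => [|k IHk] lt_kn.
    have -> : Ordinal lt_kn = ord0 by apply: val_inj.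
    by rewrite tperm1 group1.
  have lt_k : (k < n.+1)%N by apply: ltnW.
  have [k0|k_gt0] := posnP k.
    have lt0 : (0 < n)%N by rewrite -k0 -ltnS.
    have -> : tperm ord0 (Ordinal lt_kn) = @adj n.+1 (Ordinal lt0); last exact: adjA.
    by rewrite /adj; congr tperm; apply: val_inj; rewrite //= k0.
  pose i : 'I_n.+1.-1 := Ordinal (lt_kn : (k < n)%N).
  have -> : tperm ord0 (Ordinal lt_kn) = (tperm ord0 (Ordinal lt_k) ^ adj i)%g.
    rewrite tpermJ; congr tperm; rewrite /adj.
      rewrite tpermD // -val_eqE /= ?neq_ltn ?k_gt0 ?orbT //.
    have -> : Ordinal lt_k = Ordinal (adj_lt0 i) by apply: val_inj.
    by rewrite tpermL; apply: val_inj.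
  by rewrite groupJ.
have : w \in <<A>>%g.
  have : w \in [set: 'S_n.+1] by rewrite inE.
  rewrite -(gen_tperm (ord0 : 'I_n.+1)); apply: subsetP.
  by rewrite gen_subG; apply/subsetP => _ /imsetP[[y lt_y] _ ->].
case/gen_prodgP => m [c cA ->].
have /fin_all_exists[f cE] i : exists j : 'I_n.+1.-1, c i = adj j.
  by have /imsetP[j _ ->] := cA i; exists j.
exists [seq f i | i <- index_enum 'I_m].
by rewrite /word_perm big_map; apply: eq_bigr => i _; rewrite cE.
Qed.

Fact word_lengthP (n : nat) (w : 'S_n) :
  exists k, [exists s : k.-tuple 'I_n.-1, word_perm s == w].
Proof.
have [s <-] := word_permP w.
by exists (size s); apply/existsP; exists (in_tuple s).
Qed.

Definition coxeter_length (n : nat) (w : 'S_n) : nat := ex_minn (word_lengthP w).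

Definition reduced (n : nat) (s : seq 'I_n.-1) : bool :=
  size s == coxeter_length (word_perm s).

Fact reduced_wordP (n : nat) (w : 'S_n) :
  exists s : seq 'I_n.-1, reduced s && (word_perm s == w).
Proof.
rewrite /reduced; have: [exists s : (coxeter_length w).-tuple 'I_n.-1, word_perm s == w].
  by rewrite /coxeter_length; case: ex_minnP.
by case/existsP => s /eqP sw; exists s; rewrite sw size_tuple !eqxx.
Qed.

Definition reduced_word (n : nat) (w : 'S_n) : seq 'I_n.-1 :=
  xchoose (reduced_wordP w).

(* Formal noncommutative polynomials over F in the generators T_i. *)
Inductive hecke_expr (F : fieldType) (n : nat) : Type :=
  | HCst of F
  | HGen of 'I_n.-1
  | HAdd of hecke_expr F n & hecke_expr F n
  | HMul of hecke_expr F n & hecke_expr F n.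

Arguments HCst {F n}.
Arguments HGen {F n}.

(* The smallest congruence for which the quotient is a unital associative
   F-algebra (with structure map HCst) satisfying the Hecke relations. *)
Inductive hecke_eq (F : fieldType) (q : F) (n : nat) :
    hecke_expr F n -> hecke_expr F n -> Prop :=
  | heq_refl x : hecke_eq q x x
  | heq_sym x y : hecke_eq q x y -> hecke_eq q y x
  | heq_trans x y z : hecke_eq q x y -> hecke_eq q y z -> hecke_eq q x z
  | heq_add x x' y y' : hecke_eq q x x' -> hecke_eq q y y' ->
      hecke_eq q (HAdd x y) (HAdd x' y')
  | heq_mul x x' y y' : hecke_eq q x x' -> hecke_eq q y y' ->
      hecke_eq q (HMul x y) (HMul x' y')
  | heq_addA x y z : hecke_eq q (HAdd x (HAdd y z)) (HAdd (HAdd x y) z)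
  | heq_addC x y : hecke_eq q (HAdd x y) (HAdd y x)
  | heq_add0 x : hecke_eq q (HAdd (HCst 0) x) x
  | heq_addN x : hecke_eq q (HAdd (HMul (HCst (-1)) x) x) (HCst 0)
  | heq_mulA x y z : hecke_eq q (HMul x (HMul y z)) (HMul (HMul x y) z)
  | heq_mul1 x : hecke_eq q (HMul (HCst 1) x) x
  | heq_mulDl x y z :
      hecke_eq q (HMul (HAdd x y) z) (HAdd (HMul x z) (HMul y z))
  | heq_mulDr x y z :
      hecke_eq q (HMul x (HAdd y z)) (HAdd (HMul x y) (HMul x z))
  | heq_cstD a b : hecke_eq q (HCst (a + b)) (HAdd (HCst a) (HCst b))
  | heq_cstM a b : hecke_eq q (HCst (a * b)) (HMul (HCst a) (HCst b))
  | heq_cstC a x : hecke_eq q (HMul (HCst a) x) (HMul x (HCst a))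
  | heq_quad i : hecke_eq q
      (HMul (HAdd (HGen i) (HCst (- q))) (HAdd (HGen i) (HCst q^-1))) (HCst 0)
  | heq_comm (i j : 'I_n.-1) : (i.+1 < j)%N ->
      hecke_eq q (HMul (HGen i) (HGen j)) (HMul (HGen j) (HGen i))
  | heq_braid (i j : 'I_n.-1) : j = i.+1 :> nat ->
      hecke_eq q (HMul (HMul (HGen i) (HGen j)) (HGen i))
                 (HMul (HMul (HGen j) (HGen i)) (HGen j)).

HB.instance Definition _ (F : fieldType) (n : nat) :=
  gen_eqMixin (hecke_expr F n).
HB.instance Definition _ (F : fieldType) (n : nat) :=
  gen_choiceMixin (hecke_expr F n).

Section HeckeAlgebra.
Variables (F : fieldType) (q : F) (n : nat).

Definition hecke_rel : rel (hecke_expr F n) := fun x y => `[< hecke_eq q x y >].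

Fact hecke_rel_refl : reflexive hecke_rel.
Proof. by move=> x; apply/asboolP/heq_refl. Qed.

Fact hecke_rel_sym : symmetric hecke_rel.
Proof. by move=> x y; apply/asboolP/asboolP; apply: heq_sym. Qed.

Fact hecke_rel_trans : transitive hecke_rel.
Proof.
by move=> y x z /asboolP xy /asboolP yz; apply/asboolP; apply: heq_trans yz.
Qed.

Canonical hecke_equiv := EquivRel hecke_rel hecke_rel_refl hecke_rel_sym hecke_rel_trans.

Definition hecke : Type := {eq_quot hecke_equiv}%qT.

HB.instance Definition _ := Choice.on hecke.
HB.instance Definition _ := EqQuotient.on hecke.

Definition hclass (x : hecke_expr F n) : hecke := (\pi_hecke x)%qT.

Lemma hclassP x y : hclass x = hclass y <-> hecke_eq q x y.
Proof.
split; first by move/eqmodP/asboolP.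
by move=> xy; apply/eqmodP/asboolP.
Qed.

Definition hadd (a b : hecke) : hecke := hclass (HAdd (repr a) (repr b)).
Definition hmul (a b : hecke) : hecke := hclass (HMul (repr a) (repr b)).
Definition hopp (a : hecke) : hecke := hclass (HMul (HCst (-1)) (repr a)).
Definition hscale (c : F) (a : hecke) : hecke := hclass (HMul (HCst c) (repr a)).

Lemma hclass_ind (P : hecke -> Prop) : (forall x, P (hclass x)) -> forall a, P a.
Proof. by move=> Px a; rewrite -[a]reprK; apply: Px. Qed.

Lemma hclass_repr x : hecke_eq q (repr (hclass x)) x.
Proof. by apply/hclassP; rewrite /hclass reprK. Qed.

Lemma haddE x y : hadd (hclass x) (hclass y) = hclass (HAdd x y).
Proof. by apply/hclassP/heq_add; apply: hclass_repr. Qed.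

Lemma hmulE x y : hmul (hclass x) (hclass y) = hclass (HMul x y).
Proof. by apply/hclassP/heq_mul; apply: hclass_repr. Qed.

Lemma hscaleE c x : hscale c (hclass x) = hclass (HMul (HCst c) x).
Proof. by apply/hclassP/heq_mul; [apply: heq_refl|apply: hclass_repr]. Qed.

Fact haddA : associative hadd.
Proof.
move=> a b c; elim/hclass_ind: a => x; elim/hclass_ind: b => y.
by elim/hclass_ind: c => z; rewrite !haddE; apply/hclassP/heq_addA.
Qed.

Fact haddC : commutative hadd.
Proof.
move=> a b; elim/hclass_ind: a => x; elim/hclass_ind: b => y.
by rewrite !haddE; apply/hclassP/heq_addC.
Qed.

Fact hadd0 : left_id (hclass (HCst 0)) hadd.
Proof.
by elim/hclass_ind => x; rewrite haddE; apply/hclassP/heq_add0.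
Qed.

Fact haddN : left_inverse (hclass (HCst 0)) hopp hadd.
Proof.
elim/hclass_ind => x.
by rewrite /hopp -/(hscale _ _) hscaleE haddE; apply/hclassP/heq_addN.
Qed.

HB.instance Definition _ := GRing.isZmodule.Build hecke haddA haddC hadd0 haddN.

Lemma hclassD x y : hclass x + hclass y = hclass (HAdd x y).
Proof. exact: haddE. Qed.

Fact hmulA : associative hmul.
Proof.
move=> a b c; elim/hclass_ind: a => x; elim/hclass_ind: b => y.
by elim/hclass_ind: c => z; rewrite !hmulE; apply/hclassP/heq_mulA.
Qed.

Fact hmul1 : left_id (hclass (HCst 1)) hmul.
Proof.
by elim/hclass_ind => x; rewrite hmulE; apply/hclassP/heq_mul1.
Qed.

Fact hmulr1 : right_id (hclass (HCst 1)) hmul.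
Proof.
elim/hclass_ind => x; rewrite hmulE; apply/hclassP.
by apply: heq_trans (heq_mul1 q x); apply/heq_sym/heq_cstC.
Qed.

Fact hmulDl : left_distributive hmul +%R.
Proof.
move=> a b c; elim/hclass_ind: a => x; elim/hclass_ind: b => y.
elim/hclass_ind: c => z; rewrite !(hclassD, hmulE).
exact/hclassP/heq_mulDl.
Qed.

Fact hmulDr : right_distributive hmul +%R.
Proof.
move=> a b c; elim/hclass_ind: a => x; elim/hclass_ind: b => y.
elim/hclass_ind: c => z; rewrite !(hclassD, hmulE).
exact/hclassP/heq_mulDr.
Qed.

(* The algebra is nontrivial because T_i |-> q satisfies the relations. *)
Fixpoint heval_q (x : hecke_expr F n) : F :=
  match x with
  | HCst c => c
  | HGen _ => q
  | HAdd y z => heval_q y + heval_q z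
  | HMul y z => heval_q y * heval_q z
  end.

Lemma heval_qP x y : hecke_eq q x y -> heval_q x = heval_q y.
Proof.
elim=> {x y} //=.
- by move=> x y z _ -> _ ->.
- by move=> x x' y y' _ -> _ ->.
- by move=> x x' y y' _ -> _ ->.
- by move=> x y z; rewrite addrA.
- by move=> x y; rewrite addrC.
- by move=> x; rewrite add0r.
- by move=> x; rewrite mulN1r addNr.
- by move=> x y z; rewrite mulrA.
- by move=> x; rewrite mul1r.
- by move=> x y z; rewrite mulrDl.
- by move=> x y z; rewrite mulrDr.
- by move=> a x; rewrite mulrC.
- by rewrite subrr mul0r.
Qed.

Fact hone_neq0 : hclass (HCst 1) != 0.
Proof. by apply/eqP => /hclassP/heval_qP /= /eqP; rewrite oner_eq0. Qed.

HB.instance Definition _ := GRing.Zmodule_isNzRing.Build hecke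
  hmulA hmul1 hmulr1 hmulDl hmulDr hone_neq0.

Lemma hclassM x y : hclass x * hclass y = hclass (HMul x y).
Proof. exact: hmulE. Qed.

Fact hscaleA a b v : hscale a (hscale b v) = hscale (a * b) v.
Proof.
elim/hclass_ind: v => x; rewrite !hscaleE -!hmulE hmulA; congr (hmul _ _).
by rewrite hmulE; apply/hclassP/heq_sym/heq_cstM.
Qed.

Fact hscale1 : left_id 1 hscale.
Proof. by elim/hclass_ind => x; rewrite hscaleE -hmulE hmul1. Qed.

Fact hscaleDr : right_distributive hscale +%R.
Proof.
move=> c a b; elim/hclass_ind: a => x; elim/hclass_ind: b => y.
by rewrite hclassD !hscaleE hclassD; apply/hclassP/heq_mulDr.
Qed.

Fact hscaleDl v : {morph hscale^~ v : a b / a + b}.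
Proof.
elim/hclass_ind: v => x a b; rewrite !hscaleE -!hmulE -hmulDl.
by congr (hmul _ _); rewrite hclassD; apply/hclassP/heq_cstD.
Qed.

HB.instance Definition _ := GRing.Zmodule_isLmodule.Build F hecke
  hscaleA hscale1 hscaleDr hscaleDl.

Lemma hclassZ c x : c *: hclass x = hclass (HCst c) * hclass x.
Proof. by rewrite hclassM; apply: hscaleE. Qed.

Fact hscaleAl (c : F) (a b : hecke) : c *: (a * b) = (c *: a) * b.
Proof.
elim/hclass_ind: a => x; elim/hclass_ind: b => y.
by rewrite hclassM !hclassZ -hclassM mulrA.
Qed.

HB.instance Definition _ := GRing.Lmodule_isLalgebra.Build F hecke hscaleAl.

Fact hscaleAr (c : F) (a b : hecke) : c *: (a * b) = a * (c *: b).
Proof.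
elim/hclass_ind: a => x; elim/hclass_ind: b => y.
rewrite hclassM !hclassZ -hclassM !mulrA; congr (_ * _).
by rewrite !hclassM; apply/hclassP/heq_cstC.
Qed.

HB.instance Definition _ := GRing.Lalgebra_isAlgebra.Build F hecke hscaleAr.

Definition hunit : pred hecke := fun a => `[< exists b, b * a = 1 /\ a * b = 1 >].

Definition hinv (a : hecke) : hecke :=
  if pselect (exists b, b * a = 1 /\ a * b = 1) is left ab
  then projT1 (cid ab) else a.

Fact hmulVr : {in hunit, left_inverse 1 hinv *%R}.
Proof.
move=> a /asboolP ab; rewrite /hinv; case: pselect => // ab'.
by case: cid => b [].
Qed.

Fact hdivrr : {in hunit, right_inverse 1 hinv *%R}.
Proof.
move=> a /asboolP ab; rewrite /hinv; case: pselect => // ab'.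
by case: cid => b [].
Qed.

Fact hunitP (a b : hecke) : b * a = 1 /\ a * b = 1 -> hunit a.
Proof. by move=> ab; apply/asboolP; exists b. Qed.

Fact hinv_out : {in [predC hunit], hinv =1 id}.
Proof.
move=> a; rewrite inE => /asboolPn nab.
by rewrite /hinv; case: pselect.
Qed.

HB.instance Definition _ :=
  GRing.NzRing_hasMulInverse.Build hecke hmulVr hdivrr hunitP hinv_out.

(* T_1, ..., T_{n-1}, indexed from 0 like the generators of 'S_n *)
Definition hT (i : 'I_n.-1) : hecke := hclass (HGen i).

(* By Matsumoto's theorem, the value does not depend on the reduced word. *)
Definition hTw (w : 'S_n) : hecke := \prod_(i <- reduced_word w) hT i.

End HeckeAlgebra.

Section FixedSubalgebra.
Variables (F : fieldType) (A : algType F) (f : {lrmorphism A -> A}).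

Definition fixed_pred : {pred A} := fun x => f x == x.

Fact fixed_subalg_closed : subalg_closed fixed_pred.
Proof.
split=> [|c x y|x y]; rewrite -!topredE /= /fixed_pred.
- by rewrite rmorph1.
- by move=> /eqP fx /eqP fy; rewrite linearP /= fx fy.
- by move=> /eqP fx /eqP fy; rewrite rmorphM /= fx fy.
Qed.

HB.instance Definition _ :=
  GRing.isSubalgClosed.Build F A fixed_pred fixed_subalg_closed.

Record fixed_subalg : Type := FixedSubalg {
  fixed_val :> A;
  fixed_valP : fixed_val \in fixed_pred
}.

HB.instance Definition _ := [isSub for fixed_val].
HB.instance Definition _ := [Choice of fixed_subalg by <:].
HB.instance Definition _ :=
  [SubChoice_isSubAlgebra of fixed_subalg by <:].

End FixedSubalgebra.

(* A is isomorphic, as a unital F-algebra, to a finite direct product of full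
   matrix algebras over F: the f i are the components of the isomorphism. *)
Definition split_semisimple (F : fieldType) (A : algType F) : Prop :=
  exists (r : nat) (d : 'I_r -> nat)
         (f : forall i : 'I_r, {lrmorphism A -> 'M[F]_((d i).+1)}),
    (forall a b : A, (forall i, f i a = f i b) -> a = b) /\
    (forall M : forall i : 'I_r, 'M[F]_((d i).+1), exists a, forall i, f i a = M i).

(* The characterization of the automorphism #; it determines # uniquely,
   because the T_w span the Hecke algebra. *)
Definition is_hash (F : fieldType) (q : F) (n : nat)
    (hash : {lrmorphism hecke q n -> hecke q n}) : Prop :=
  bijective hash /\
  forall w : 'S_n, hash (hTw q w) = (-1) ^+ coxeter_length w * (hTw q w^-1%g)^-1.

Definition alternating_hecke (F : fieldType) (q : F) (n : nat)
  (hash : {lrmorphism hecke q n -> hecke q n}) : algType F := fixed_subalg hash.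

(* Main.v *)
(* The Hecke algebra acts in seminormal form on functions on the standard
   tableaux of size n: T_i is a combination of the identity and of the exchange of
   i and i+1, with coefficients in the contents of the two boxes.  The
   Jucys-Murphy elements act diagonally and, since [k] <> 0 for k <= n, separate
   tableaux, so that all matrix units between tableaux of the same shape occur;
   as the algebra is spanned by n! elements and the numbers f of standard tableaux
   of the shapes of size n satisfy sum f^2 = n!, it is the product of the matrix
   algebras of size f.

   The automorphism # becomes conjugation by a rescaled transposition J of
   tableaux.  On a shape which is not self-conjugate the fixed algebra is a full
   matrix algebra, shared with the conjugate shape; on a self-conjugate one it is
   the commutant of J, which is the product of two matrix algebras over F as soon
   as the scalar J^2 is a square.  This scalar is a product, over pairs of boxes
   with content difference d, |d| > 1, of [1+d][1-d]/q^2.  For d even the factor is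
   a square because the [2m+1] and -1 are; the pairs with d odd are matched two by
   two by transposing the shape. *)

From HB Require Import structures.
Require Import Defs.
From mathcomp Require Import all_boot all_order all_fingroup all_algebra.
From mathcomp Require Import generic_quotient boolp.
From mathcomp Require Import zify ring.

Set Implicit Arguments.
Unset Strict Implicit.
Unset Printing Implicit Defensive.

Import Order.TTheory GRing.Theory Num.Theory.
Local Open Scope ring_scope.

(** * Split semisimplicity from matrix coefficients *)

(** The obstacle is arithmetic. The seminormal form is taken with unnormalised exchanges, so its
    coefficients are rational in q, and roots enter only when J is scaled to an involution. A pair
    with odd content difference contains exactly one odd, hence nonzero, content; so transposition,
    which negates contents, sends it to a different pair. For d even, 1+d and 1-d are odd and of
    absolute value at most n, because contents of a tableau of size n differ by less than n;
    negative arguments are reduced by [-k] = -q^{-2k}[k], which is where the root of -1 enters.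

    Once J^2 = 1, fixed elements preserve both eigenspaces of J. On two conjugate shapes these are
    isomorphic and one is kept; on a self-conjugate shape both are kept. The content of box 2 is 1
    or -1 and transposition changes its sign, so tableaux with content 1 there index bases of the
    eigenspaces in both cases. This needs n at least 2, and n = 1 is separate.

    Tableaux are words of contents: a shape is a word up to permutation, and transposition is
    negation. *)

Section MatrixCoefficients.
Variables (F : fieldType) (A : algType F) (Y S : eqType) (xs : seq Y).
Variables (sh : Y -> S) (rho : A -> Y -> Y -> F).
Hypothesis xs_uniq : uniq xs.
Hypothesis rhoP : forall c a b x y, x \in xs -> y \in xs ->
  rho (c *: a + b) x y = c * rho a x y + rho b x y.
Hypothesis rho1 : forall x y, x \in xs -> y \in xs -> rho 1 x y = (x == y)%:R.
Hypothesis rhoM : forall a b x y, x \in xs -> y \in xs ->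
  rho (a * b) x y = \sum_(u <- xs) rho a x u * rho b u y.
Hypothesis rho_block : forall a x y, x \in xs -> y \in xs ->
  sh x != sh y -> rho a x y = 0.

Let block (s : S) := [seq x <- xs | sh x == s].

Section Block.
Variables (s : S) (x0 : Y).

(** The size is written as a successor, as the ring structure on square matrices demands; by
    [block_gt0] it is the true size of the block. *)
Definition block_repr (a : A) : 'M[F]_((size (block s)).-1.+1) :=
  \matrix_(i, j) rho a (nth x0 (block s) i) (nth x0 (block s) j).

Hypothesis block_gt0 : (0 < size (block s))%N.

Let mem_block (i : 'I_((size (block s)).-1.+1)) : nth x0 (block s) i \in block s.
Proof. by apply: mem_nth; rewrite -[X in (_ < X)%N](prednK block_gt0). Qed.

Let mem_xs (i : 'I_((size (block s)).-1.+1)) : nth x0 (block s) i \in xs.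
Proof. by have := mem_block i; rewrite mem_filter => /andP[]. Qed.

Let sh_block (i : 'I_((size (block s)).-1.+1)) : sh (nth x0 (block s) i) = s.
Proof. by have := mem_block i; rewrite mem_filter => /andP[/eqP]. Qed.

Fact block_repr_linear : linear block_repr.
Proof. by move=> c a b; apply/matrixP => i j; rewrite !mxE rhoP. Qed.

Fact block_repr_monoid : monoid_morphism block_repr.
Proof.
split=> [|a b]; apply/matrixP => i j; rewrite !mxE.
  rewrite rho1 // nth_uniq ?filter_uniq //;
    by rewrite -[X in (_ < X)%N](prednK block_gt0).
rewrite rhoM // (bigID (fun u => sh u == s)) /= [X in _ + X]big_seq_cond.
rewrite [X in _ + X]big1 ?addr0 => [|u /andP[u_xs shu]]; last first.
  by rewrite rho_block ?mul0r // sh_block eq_sym.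
rewrite -big_filter (big_nth x0) -/(block s).
under [RHS]eq_bigr do rewrite !mxE.
set x := nth _ _ i; set y := nth _ _ j.
rewrite -(big_mkord xpredT
  (fun k => rho a x (nth x0 (block s) k) * rho b (nth x0 (block s) k) y)).
by rewrite prednK.
Qed.

Definition block_morphism : {lrmorphism A -> 'M[F]_((size (block s)).-1.+1)} :=
  HB.pack block_repr
    (GRing.isLinear.Build F A _ _ block_repr block_repr_linear)
    (GRing.isMonoidMorphism.Build A _ block_repr block_repr_monoid).

End Block.

Hypothesis rho_inj : forall a, {in xs &, forall x y, rho a x y = 0} -> a = 0.
Hypothesis rho_surj : forall M : Y -> Y -> F,
  {in xs &, forall x y, sh x != sh y -> M x y = 0} ->
  exists a, {in xs &, forall x y, rho a x y = M x y}.

Lemma split_semisimple_of_coefs : split_semisimple A.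
Proof.
(* With no index at all, [rho_inj] would give 1 = 0. *)
have [x0 x0_xs] : exists x, x \in xs.
  case: (xs) rho_inj => [|x s _]; last by exists x; rewrite mem_head.
  by move=> inj; have /eqP := inj 1 (fun x => ltac:(done)); rewrite oner_eq0.
pose cl := undup [seq sh x | x <- xs]; pose s0 := sh x0.
have cl_gt0 (i : 'I_(size cl)) : (0 < size (block (nth s0 cl i)))%N.
  have : nth s0 cl i \in cl by apply: mem_nth.
  rewrite mem_undup => /mapP[x x_xs ->]; rewrite size_filter -has_count.
  by apply/hasP; exists x.
exists (size cl), (fun i => (size (block (nth s0 cl i))).-1).
exists (fun i => block_morphism x0 (cl_gt0 i)); split=> [a b ab|M].
  apply/eqP; rewrite -subr_eq0; apply/eqP/rho_inj => x y x_xs y_xs.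
  have [shxy|] := eqVneq (sh x) (sh y); last exact: rho_block.
  have cl_x : sh x \in cl by rewrite mem_undup map_f.
  have i_lt : (index (sh x) cl < size cl)%N by rewrite index_mem.
  pose i := Ordinal i_lt.
  have Ei : nth s0 cl i = sh x by rewrite /= nth_index.
  have bl z : z \in xs -> sh z = sh x -> (index z (block (nth s0 cl i)) <
       (size (block (nth s0 cl i))).-1.+1)%N.
    move=> z_xs shz; rewrite prednK // index_mem mem_filter z_xs Ei shz eqxx //.
  have /matrixP/(_ (Ordinal (bl x x_xs erefl))
     (Ordinal (bl y y_xs (esym shxy)))) := ab i.
  rewrite !mxE /= !nth_index ?mem_filter ?x_xs ?y_xs //=
    ?nth_index ?shxy ?eqxx // => Eab.
  by rewrite addrC -scaleN1r rhoP // mulN1r Eab addNr.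
(* The family of blocks as a single function: the classes in [cl] are distinct, so at most one
   summand survives. *)
pose Mxy x y := \sum_(i < size cl)
  if (sh x == nth s0 cl i) && (sh y == nth s0 cl i) then
    M i (inord (index x (block (nth s0 cl i))))
        (inord (index y (block (nth s0 cl i)))) else 0.
have [|a aM] := rho_surj (M := Mxy).
  move=> x y _ _ neq_xy; apply: big1 => i _; case: ifP => // /andP[/eqP Ex /eqP Ey].
  by rewrite Ex Ey eqxx in neq_xy.
exists a => i; apply/matrixP => j k; rewrite mxE.
have mem_bl (l : 'I_((size (block (nth s0 cl i))).-1.+1)) :
    nth x0 (block (nth s0 cl i)) l \in block (nth s0 cl i).
  by apply: mem_nth; rewrite -[X in (_ < X)%N](prednK (cl_gt0 i)).
have mem_bl' (l : 'I_((size (block (nth s0 cl i))).-1.+1)) :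
   (nth x0 (block (nth s0 cl i)) l \in xs) *
   (sh (nth x0 (block (nth s0 cl i)) (nat_of_ord l)) = nth s0 cl i).
  by have := mem_bl l; rewrite mem_filter => /andP[/eqP].
rewrite aM ?mem_bl' // /Mxy (bigD1 i) //= !mem_bl' !eqxx /=.
rewrite big1 ?addr0 => [|i' /negPf i'i].
  have idx (l : 'I_((size (block (nth s0 cl i))).-1.+1)) :
     inord (index (nth x0 (block (nth s0 cl i)) l)
       (block (nth s0 cl i))) = l :> 'I_((size (block (nth s0 cl i))).-1.+1).
    rewrite index_uniq ?filter_uniq ?inord_val //.
    by rewrite -[X in (_ < X)%N](prednK (cl_gt0 i)).
  by rewrite !idx.
by rewrite nth_uniq ?undup_uniq // eq_sym [_ == _]i'i.
Qed.

End MatrixCoefficients.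

(** * Quantum integers and seminormal coefficients *)

Section QuantumIntegers.
Variables (F : fieldType) (q : F).
Hypothesis q_neq0 : q != 0.

(** Contents are signed; the values at negative integers are forced by [x+1] = q^2 [x] + q. *)
Definition qintz (x : int) : F :=
  match x with
  | Posz k => qint q k
  | Negz k => - (q ^+ 2) ^- k.+1 * qint q k.+1
  end.

Lemma qintS k : qint q k.+1 = q ^+ 2 * qint q k + q.
Proof.
rewrite /qint big_ord_recl mulr_sumr addrC muln0 expr1; congr (_ + _).
by apply: eq_bigr => i _; rewrite -exprD lift0 mulnS.
Qed.

Lemma qint0 : qint q 0 = 0.
Proof. by rewrite /qint big_ord0. Qed.

Lemma qintzS x : qintz (x + 1) = q ^+ 2 * qintz x + q.
Proof.
case: x => [k|[|k]]; first by rewrite -PoszD addn1 /= qintS.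
  by rewrite /= qintS qint0 ; field.
have -> : Negz k.+1 + 1 = Negz k by lia.
have q2k : (q ^+ 2) ^+ k.+1 != 0 by rewrite !expf_neq0.
have E : qint q k.+2 = qint q k.+1 + q * (q ^+ 2) ^+ k.+1.
  by rewrite /qint big_ord_recr /= -exprM -exprS.
by rewrite /= E (exprS _ k.+1); field; rewrite q2k.
Qed.

Lemma qintz0 : qintz 0 = 0. Proof. exact: qint0. Qed.

Lemma qintz1 : qintz 1 = q.
Proof. by rewrite -[1]add0r qintzS qintz0 mulr0 add0r. Qed.

Lemma qintzD x y : qintz (x + y) = qintz x + (q ^+ 2) ^ x * qintz y.
Proof.
have q2 : q ^+ 2 != 0 by rewrite expf_neq0.
elim/int_ind: x => [|k IHk|k IHk]; first by rewrite add0r qintz0 expr0z mul1r add0r.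
  have -> : k.+1%:Z + y = (k%:Z + y) + 1 by lia.
  have -> : k.+1%:Z = k%:Z + 1 by lia.
  by rewrite !qintzS IHk expfzDr // expr1z; ring.
have Eq u : q ^+ 2 * qintz (u - 1) + q = qintz u by rewrite -qintzS subrK.
have {}Eq u : qintz (u - 1) = (q ^+ 2)^-1 * (qintz u - q) by rewrite -(Eq u); field.
have -> : - k.+1%:Z + y = (- k%:Z + y) - 1 by lia.
have -> : - k.+1%:Z = - k%:Z - 1 by lia.
rewrite (Eq (- k%:Z + y)) IHk (Eq (- k%:Z)) expfzDr // exprN1; ring.
Qed.

Lemma qintzB x y : qintz y - qintz x = (q ^+ 2) ^ x * qintz (y - x).
Proof. by have := qintzD x (y - x); rewrite [x + _]addrC subrK => ->; ring. Qed.

Lemma qintzN x : qintz (- x) = - (q ^+ 2) ^ (- x) * qintz x.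
Proof.
by have := qintzD (- x) x; rewrite addNr qintz0 mulNr => /eqP;
  rewrite eq_sym addr_eq0 => /eqP.
Qed.

(** q^{2x} is affine in [x], also when q^2 = 1. So the numerator of [diag_coef x y] is q^{2y}, and
    the relations below become identities of rational functions in the values [x], within reach of
    [field]. *)
Lemma qintz_exp x : 1 + (q - q^-1) * qintz x = (q ^+ 2) ^ x.
Proof.
have q2 : q ^+ 2 != 0 by rewrite expf_neq0.
have := qintzD x 1; rewrite (addrC x) (qintzD 1 x) qintz1 expr1z => E.
apply: (mulIf q_neq0); apply: (addrI (qintz x)); rewrite -E.
by field.
Qed.

(* In the seminormal form, with [a = qintz x] and [b = qintz y] for the contents
   [x], [y] of the boxes of [i] and [i+1], [diag_coef x y] and [off_coef x y] are the
   diagonal and off-diagonal coefficients of [T_i]. *)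
Definition off_num (x y : int) : F := 1 + q * qintz y - q^-1 * qintz x.

Definition diag_coef (x y : int) : F :=
  (1 + (q - q^-1) * qintz y) / (qintz y - qintz x).

Definition off_coef (x y : int) : F :=
  if (`|x - y| <= 1)%N then 0 else off_num x y / (qintz y - qintz x).

Lemma snumE x y : off_num x y = q^-1 * (q ^+ 2) ^ x * qintz (y + 1 - x).
Proof. by rewrite -mulrA -qintzB qintzS /off_num; field. Qed.

Section Distinct.
Variables x y : int.
Hypothesis xy : qintz x != qintz y.
Let xyB : qintz y - qintz x != 0. Proof. by rewrite subr_eq0 eq_sym. Qed.
Let yxB : qintz x - qintz y != 0. Proof. by rewrite subr_eq0. Qed.

Lemma diag_coef_sym : diag_coef x y + diag_coef y x = q - q^-1.
Proof. by rewrite /diag_coef; field; rewrite q_neq0 xyB yxB. Qed.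

(** With [diag_coef_sym]: the two-by-two block of T_i has trace q - q^{-1} and determinant -1, which
    is the quadratic relation. For adjacent contents the cut-off in [off_coef] makes the left side
    0, and the diagonal coefficient is itself q or -q^{-1}. *)
Lemma off_coef_sym :
  off_coef x y * off_coef y x = (diag_coef x y + q^-1) * (q - diag_coef x y).
Proof.
have nxy : x != y by apply: contraNneq xy => ->.
rewrite /off_coef [`|y - x|%N]distnC; case: ifP => [adj_xy|_]; last first.
  by rewrite /diag_coef /off_num; field; rewrite q_neq0 xyB yxB.
rewrite mul0r; apply/esym/eqP; rewrite mulf_eq0.
have [yE|xE] : y = x + 1 \/ x = y + 1 by lia.
  apply/orP; right; apply/eqP; apply: (mulIf xyB).
  by rewrite /diag_coef mulrBl divfK // yE qintzS mul0r; field.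
apply/orP; left; apply/eqP; apply: (mulIf xyB).
by rewrite /diag_coef mulrDl divfK // xE qintzS mul0r; field.
Qed.

End Distinct.

Lemma exprz_neq0 x : (q ^+ 2) ^ x != 0.
Proof. by rewrite expfz_neq0 // expf_neq0. Qed.

Lemma exprzNM x : (q ^+ 2) ^ (- x) * (q ^+ 2) ^ x = 1.
Proof. by rewrite -expfzDr ?expf_neq0 // addNr expr0z. Qed.

Lemma qintzB_neq0 x y : (qintz (x - y) != 0) = (qintz x != qintz y).
Proof. by rewrite -[in RHS]subr_eq0 qintzB mulf_eq0 (negPf (exprz_neq0 y)). Qed.

(** [diag_coef x y] is q^{2(y-x)}/[y-x], which depends on the difference of the contents only. *)
Lemma diag_coef_opp x y : qintz x != qintz y -> diag_coef (- x) (- y) = diag_coef y x.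
Proof.
rewrite -qintzB_neq0 /diag_coef !qintz_exp !qintzB => xy.
have -> : - y - - x = x - y by lia.
apply: (mulIf (mulf_neq0 (exprz_neq0 (- x)) (mulf_neq0 (exprz_neq0 y) xy))).
transitivity ((q ^+ 2) ^ (- y) * (q ^+ 2) ^ y).
  by field; rewrite ?exprz_neq0 ?xy.
transitivity ((q ^+ 2) ^ (- x) * (q ^+ 2) ^ x); last by field; rewrite ?exprz_neq0 ?xy.
by rewrite !exprzNM.
Qed.

(** Conjugation negates contents and # changes the sign of the exchange term. The factors [off_num]
    by which the two exchange coefficients differ dictate the scaling of the twist. *)
Lemma off_num_off_coef_opp x y : qintz x != qintz y ->
  - off_coef x y * off_num y x = off_num x y * off_coef (- x) (- y).
Proof.
rewrite -qintzB_neq0 /off_coef -(opprB (qintz x)) !qintzB !snumE => xy.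
have -> : - y - - x = x - y by lia.
have -> : - y + 1 - - x = x + 1 - y by lia.
have -> : `|- x - - y|%N = `|x - y|%N by lia.
case: ifP => _; first by rewrite oppr0 mulr0 mul0r.
by field; rewrite oppr_eq0 mulf_neq0 ?exprz_neq0 ?q_neq0 ?xy.
Qed.

(** The braid relation on a triple of contents, coefficient by coefficient: this lemma and the next
    treat words reached by one exchange, [diag_coef_braid] the diagonal. Words reached by two or
    three exchanges have equal coefficients by commutativity. *)
Lemma diag_coef_yang_baxter x y z :
    qintz x != qintz y -> qintz y != qintz z -> qintz x != qintz z ->
  diag_coef x y * diag_coef y z + diag_coef x z * diag_coef y x
  = diag_coef y z * diag_coef x z.
Proof.
rewrite /diag_coef => xy yz xz.
have [xy0 yz0 xz0] : [/\ qintz x - qintz y != 0, qintz y - qintz z != 0 &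
   qintz x - qintz z != 0] by rewrite !subr_eq0.
have [yx zy zx] : [/\ qintz y - qintz x != 0, qintz z - qintz y != 0 &
   qintz z - qintz x != 0] by split; rewrite subr_eq0 eq_sym.
by field; rewrite ?q_neq0 ?xy0 ?yx ?zy ?zx.
Qed.

Lemma diag_coef_yang_baxter2 x y z :
    qintz x != qintz y -> qintz y != qintz z -> qintz x != qintz z ->
  diag_coef x y * diag_coef y z + diag_coef x z * diag_coef z y
  = diag_coef x y * diag_coef x z.
Proof.
rewrite /diag_coef => xy yz xz.
have [xy0 yz0 xz0] : [/\ qintz x - qintz y != 0, qintz y - qintz z != 0 &
   qintz x - qintz z != 0] by rewrite !subr_eq0.
have [yx zy zx] : [/\ qintz y - qintz x != 0, qintz z - qintz y != 0 &
   qintz z - qintz x != 0] by split; rewrite subr_eq0 eq_sym.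
by field; rewrite ?q_neq0 ?yz0 ?yx ?zy ?zx.
Qed.

(** This and the next lemma give the diagonal and off-diagonal coefficients of T L T + T on a word
    and its exchange, where L has eigenvalues [x] and [y]: the induction step for the Jucys-Murphy
    elements. *)
Lemma diag_coef_diag x y : qintz x != qintz y ->
  diag_coef x y ^+ 2 * qintz x + off_coef x y * off_coef y x * qintz y + diag_coef x y = qintz y.
Proof.
move=> xy; rewrite off_coef_sym // /diag_coef; move: xy; rewrite -subr_eq0 => xy.
have yx : qintz y - qintz x != 0 by rewrite -oppr_eq0 opprB.
by field; rewrite ?q_neq0 ?yx.
Qed.

Lemma diag_coef_offdiag x y : qintz x != qintz y ->
  diag_coef x y * qintz x + diag_coef y x * qintz y + 1 = 0.
Proof.
rewrite -subr_eq0 => xy; rewrite /diag_coef.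
have yx : qintz y - qintz x != 0 by rewrite -oppr_eq0 opprB.
by field; rewrite ?q_neq0 ?yx ?xy.
Qed.

Lemma diag_coef_braid x y z :
    qintz x != qintz y -> qintz y != qintz z -> qintz x != qintz z ->
  diag_coef x y ^+ 2 * diag_coef y z + off_coef x y * off_coef y x * diag_coef x z =
  diag_coef y z ^+ 2 * diag_coef x y + off_coef y z * off_coef z y * diag_coef x z.
Proof.
move=> xy yz xz; rewrite !off_coef_sym // /diag_coef.
have [xy0 yz0 xz0] : [/\ qintz x - qintz y != 0, qintz y - qintz z != 0 &
   qintz x - qintz z != 0] by rewrite !subr_eq0.
have [yx zy zx] : [/\ qintz y - qintz x != 0, qintz z - qintz y != 0 &
   qintz z - qintz x != 0] by split; rewrite subr_eq0 eq_sym.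
by field; rewrite ?q_neq0 ?yx ?zy ?zx.
Qed.

Section Generic.
Variable n : nat.
Hypothesis q_gen : forall k : nat, (1 <= k <= n)%N -> qint q k != 0.

Lemma qintz_neq0 d : d != 0 -> (`|d| <= n)%N -> qintz d != 0.
Proof.
move=> d0 dn; have abs_d : qintz `|d| != 0 by apply: q_gen; lia.
have [->//|->] : d = `|d| \/ d = - `|d| by lia.
by rewrite qintzN mulNr oppr_eq0 mulf_neq0 // exprz_neq0.
Qed.

Lemma qintz_inj x y : x != y -> (`|x - y| <= n)%N -> qintz x != qintz y.
Proof. by move=> xy; rewrite -qintzB_neq0; apply: qintz_neq0; rewrite subr_eq0. Qed.

Lemma off_num_neq0 x y : (1 < `|x - y| < n)%N -> off_num x y != 0.
Proof.
move=> xy; rewrite snumE !mulf_neq0 ?exprz_neq0 ?invr_neq0 //.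
by apply: qintz_neq0; lia.
Qed.

Lemma off_coef_neq0 x y : (1 < `|x - y| < n)%N -> off_coef x y != 0.
Proof.
move=> xy; rewrite /off_coef ifF ?mulf_neq0 ?off_num_neq0 ?invr_neq0 ?subr_eq0 //; last by lia.
by rewrite qintz_inj //; lia.
Qed.

End Generic.
End QuantumIntegers.

(** * Partitions and standard tableaux as words of contents *)

Definition mult (w : seq int) (c : int) : nat := count_mem c w.

Lemma mult_cons x w c : mult (x :: w) c = ((x == c) + mult w c)%N.
Proof. by []. Qed.

Lemma mult_gt0 w c : (0 < mult w c)%N = (c \in w).
Proof. by rewrite -has_pred1 has_count. Qed.

Lemma mult_perm w w' : perm_eq w w' -> mult w =1 mult w'.
Proof. by move=> /seq.permP ww' c; apply: ww'. Qed.

(* A partition is encoded by the multiset of contents of its boxes, and this by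
   its boundary path: [bit w k] is the k-th step of the path (the steps are
   indexed so that the empty partition has steps 1 up to index 0, then 0).
   Adding a box of content c exchanges steps 1, 0 at indices c, c+1.  A standard
   tableau is the word of the contents of its boxes 1, 2, .... *)
Definition bit (w : seq int) (k : int) : int :=
  Posz ((k <= 0)%R + mult w (k - 1)%R)%N - Posz (mult w k).

Definition addable w c := (bit w c == 1) && (bit w (c + 1) == 0).

Fixpoint std_from (p w : seq int) :=
  if w is c :: w' then addable p c && std_from (c :: p) w' else true.

Definition std w := std_from [::] w.

(** This says that the multiset [p] comes from a partition: its boundary path has only two kinds of
    steps. *)
Definition bits01 p := forall k, bit p k = 0 \/ bit p k = 1.

Fixpoint swap i (w : seq int) :=
  match i, w with
  | 0, x :: y :: s => y :: x :: s
  | i.+1, x :: s => x :: swap i s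
  | _, _ => w
  end.

Local Notation ct := (nth (0 : int)).
Local Notation conj_word w := [seq - x | x <- w].

Lemma bit_nil k : bit [::] k = (k <= 0)%R%:Z.
Proof. by rewrite /bit /mult /=; lia. Qed.

Lemma bit_cons c p k : bit (c :: p) k = bit p k + (c == k - 1)%:Z - (c == k)%:Z.
Proof. by rewrite /bit !mult_cons; lia. Qed.

Lemma bit_perm p p' : perm_eq p p' -> bit p =1 bit p'.
Proof. by move=> /mult_perm pp' k; rewrite /bit !pp'. Qed.

Lemma addable_perm p p' : perm_eq p p' -> addable p =1 addable p'.
Proof. by move=> pp' k; rewrite /addable !(bit_perm pp'). Qed.

Lemma std_from_perm p p' w : perm_eq p p' -> std_from p w = std_from p' w.
Proof.
elim: w p p' => //= c w IHw p p' pp'; rewrite (addable_perm pp').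
by rewrite (IHw _ (c :: p')) // perm_cons.
Qed.

Lemma std_from_cat p s t :
  std_from p (s ++ t) = std_from p s && std_from (s ++ p) t.
Proof.
elim: s p => //= c s IHs p; rewrite IHs -andbA; congr (_ && (_ && _)).
by apply: std_from_perm; rewrite perm_catC /= perm_cons perm_catC.
Qed.

Lemma std_cat s t : std (s ++ t) = std s && std_from s t.
Proof. by rewrite /std std_from_cat cats0. Qed.

Lemma std_rcons w c : std (rcons w c) = std w && addable w c.
Proof. by rewrite -cats1 std_cat /= andbT. Qed.

Lemma bits01_nil : bits01 [::].
Proof. by move=> k; rewrite bit_nil; case: (k <= 0); [right|left]. Qed.

Lemma bits01_addable p c : bits01 p -> addable p c -> bits01 (c :: p).
Proof.
move=> p01 /andP[/eqP b1 /eqP b0] k; rewrite bit_cons.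
have [<-|kc] := eqVneq c k; first by rewrite b1; left; lia.
have [E|kc1] := eqVneq c (k - 1); last by have := p01 k; lia.
have -> : k = c + 1 by lia.
by rewrite b0; right; lia.
Qed.

Lemma std_bits01 w : std w -> bits01 w.
Proof.
elim/last_ind: w => [|w c IHw]; first by move=> _; apply: bits01_nil.
rewrite std_rcons => /andP[/IHw w01 /(bits01_addable w01) cw01] k.
by rewrite (bit_perm (p' := c :: w)) // perm_rcons.
Qed.

Lemma addable_near p c : addable p c -> 0 < c -> c - 1 \in p.
Proof.
by rewrite -mult_gt0 /addable /bit => /andP[]; lia.
Qed.

Lemma addable_nearN p c : addable p c -> c < 0 -> c + 1 \in p.
Proof.
by rewrite -mult_gt0 /addable /bit => /andP[]; lia.
Qed.

Lemma std_interval w x c : std w -> x \in w ->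
  (0 <= c <= x) || (x <= c <= 0) -> c \in w.
Proof.
elim/last_ind: w x => [|w a IHw] x //; rewrite std_rcons => /andP[w_std wa].
rewrite !mem_rcons !inE; case: (eqVneq x a) => [->|_] /=; last first.
  by move=> xw xc; rewrite (IHw _ w_std xw xc) orbT.
case: (eqVneq c a) => //= ca _ ac.
have [a0|a0|a0] := ltgtP 0 a; last by lia.
  by apply: (IHw (a - 1)) => //; [apply: addable_near|lia].
by apply: (IHw (a + 1)) => //; [apply: addable_nearN|lia].
Qed.

Lemma interval_size (w : seq int) (x : int) m :
  (forall i : nat, (i < m)%N -> x + i%:Z \in w) -> (m <= size w)%N.
Proof.
move=> xw; rewrite -(size_iota 0 m) -(size_map (fun i : nat => x + i%:Z)).
apply: uniq_leq_size => [|_ /mapP[i im ->]].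
  by rewrite map_inj_uniq ?iota_uniq // => i j; lia.
by apply: xw; rewrite mem_iota in im; lia.
Qed.

(** All integers between two contents are contents, by [std_interval]. This is why [k] is only
    needed to be nonzero for k at most n. *)
Lemma std_content_dist w x y : std w -> x \in w -> y \in w ->
  (`|x - y| < size w)%N.
Proof.
move=> w_std; wlog le_xy : x y / x <= y.
  move=> H xw yw; have [le_xy|lt_yx] := lerP x y; first exact: H.
  by rewrite distnC; apply: H => //; lia.
move=> xw yw; apply: (@interval_size _ x) => i i_lt.
have [i0|i0] := lerP 0 (x + i%:Z).
  by apply: (std_interval w_std yw); lia.
by apply: (std_interval w_std xw); lia.
Qed.

(** The integers strictly between two addable contents occur in [w]. *)
Lemma addable_dist w x y : std w -> addable w x -> addable w y ->
  (`|x - y| <= (size w).+1)%N.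
Proof.
move=> w_std; wlog le_xy : x y / x <= y.
  move=> H xw yw; have [le_xy|lt_yx] := lerP x y; first exact: H.
  by rewrite distnC; apply: H => //; lia.
move=> xw yw; suff : ((`|x - y|).-1 <= size w)%N by lia.
apply: (@interval_size _ (x + 1)) => i i_lt.
have wx : std (rcons w x) by rewrite std_rcons w_std.
have wy : std (rcons w y) by rewrite std_rcons w_std.
have [i0|i0] := lerP 0 (x + 1 + i%:Z).
  have := std_interval (x := y) (c := x + 1 + i%:Z) wy.
  by rewrite !mem_rcons !inE eqxx => /(_ isT); case: eqP => [|_ H]; [lia|by apply: H; lia].
have := std_interval (x := x) (c := x + 1 + i%:Z) wx.
by rewrite !mem_rcons !inE eqxx => /(_ isT); case: eqP => [|_ H]; [lia|by apply: H; lia].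
Qed.

Lemma std_from_neq p x y s : std_from p [:: x, y & s] -> x != y.
Proof.
case/and3P => /andP[+ _] /andP[+ _] _; rewrite bit_cons.
by case: (eqVneq x y) => // <-; lia.
Qed.

(** Adding x turns the steps at x and x+1 from 1, 0 into 0, 1. Turning both back takes a box of
    content x-1 and one of content x+1, and there is room for only one box. *)
Lemma std_from_neq13 p x y z s : std_from p [:: x, y, z & s] -> x != z.
Proof.
case/and4P => /andP[+ +] _ /andP[+ +] _; rewrite !bit_cons.
by case: (eqVneq x z) => // <-; lia.
Qed.

Lemma std_from_swap p x y s : (1 < `|x - y|)%N ->
  std_from p [:: x, y & s] -> std_from p [:: y, x & s].
Proof.
move=> xy; rewrite /= => /and3P[px py ps]; apply/and3P; move: px py.
rewrite /addable !bit_cons => px py; split; [lia|lia|].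
by rewrite (@std_from_perm _ [:: y, x & p]) // (perm_catCA [:: x] [:: y]).
Qed.

Lemma swap_cat s t : swap (size s) (s ++ t) = s ++ swap 0 t.
Proof. by elim: s => //= x s ->. Qed.

Lemma size_swap i w : size (swap i w) = size w.
Proof. by elim: i w => [|i IHi] [|x [|y w]] //=; rewrite IHi. Qed.

Lemma swapK i : involutive (swap i).
Proof. by elim: i => [|i IHi] [|x [|y w]] //=; rewrite IHi. Qed.

Lemma perm_swap i w : perm_eq (swap i w) w.
Proof.
elim: i w => [|i IHi] [|x w] //=; last by rewrite perm_cons.
by case: w => // y w; rewrite (perm_catCA [:: y] [:: x] w).
Qed.

Lemma swap_comm i j w : (i.+1 < j)%N -> swap i (swap j w) = swap j (swap i w).
Proof.
elim: i j w => [|i IHi] [|j] [|x w] //= ij; last by rewrite IHi.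
by case: j ij w => [|j] // _ [].
Qed.

Lemma nth_swap i w k : (i.+1 < size w)%N ->
  ct (swap i w) k = ct w (if k == i then i.+1 else if k == i.+1 then i else k).
Proof.
elim: i w k => [|i IHi] [|x w] k //=; first by case: w k => [|y w] // [|[]].
rewrite ltnS => iw; case: k => [|k] //=; rewrite IHi // !eqSS.
by do 2?case: ifP.
Qed.

Lemma swap_map f i w : swap i (map f w) = map f (swap i w).
Proof. by elim: i w => [|i IHi] [|x w] //=; [case: w|rewrite IHi]. Qed.

Lemma word_split i (w : seq int) : (i.+1 < size w)%N ->
  w = take i w ++ [:: ct w i, ct w i.+1 & drop i.+2 w].
Proof.
move=> iw; rewrite -!drop_nth ?cat_take_drop //.
exact: ltnW.
Qed.

Lemma std_swap i (w : seq int) : (i.+1 < size w)%N -> (1 < `|ct w i - ct w i.+1|)%N ->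
  std w -> std (swap i w).
Proof.
move=> iw; move: (word_split iw); set x := ct w i; set y := ct w i.+1 => Ew xy.
have si : size (take i w) = i by rewrite size_takel //; lia.
rewrite Ew -{3}si swap_cat !std_cat /= -!/(std_from _ [:: _, _ & _]) => /andP[-> /=].
exact: std_from_swap.
Qed.

Lemma bit_conj w k : bit (conj_word w) k = 1 - bit w (1 - k).
Proof.
have Ec c : mult (conj_word w) c = mult w (- c).
  by rewrite /mult count_map; apply: eq_count => x /=; rewrite eqr_oppLR.
rewrite /bit !Ec.
have -> : 1 - k - 1 = - k by lia.
have -> : - (k - 1) = 1 - k by lia.
by lia.
Qed.

Lemma std_from_conj p w : std_from p w -> std_from (conj_word p) (conj_word w).
Proof.
elim: w p => //= c w IHw p /andP[/andP[b1 b0] /IHw ->]; rewrite andbT.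
rewrite /addable !bit_conj.
have -> : 1 - - c = c + 1 by lia.
have -> : 1 - (- c + 1) = c by lia.
by rewrite (eqP b0) (eqP b1).
Qed.

Lemma std_conj w : std w -> std (conj_word w).
Proof. exact: (@std_from_conj [::]). Qed.

Lemma conj_wordK (w : seq int) : conj_word (conj_word w) = w.
Proof. by rewrite -map_comp map_id_in // => x _ /=; rewrite opprK. Qed.

Lemma std_nth1 w : std w -> (1 < size w)%N -> ct w 1 = 1 \/ ct w 1 = -1.
Proof.
case: w => [|x [|y w]] //= /and3P[+ + _] _.
by rewrite /addable !bit_cons !bit_nil; lia.
Qed.

(** At the first difference both contents are addable to the same shape, of size k, so
    [addable_dist] bounds their distance. *)
Lemma std_diff u t : std u -> std t -> size u = size t -> u != t ->
  exists2 k, (k < size u)%N & ct u k != ct t k /\ (`|ct u k - ct t k| <= k.+1)%N.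
Proof.
elim/last_ind: u t => [|u a IHu] t; first by case: t.
elim/last_ind: t => [|t b _]; first by rewrite size_rcons.
rewrite !std_rcons !size_rcons => /andP[u_std ua] /andP[t_std tb] [sut].
have [Eut|ut] := eqVneq u t; last first.
  move=> _; have [k k_lt kP] := IHu t u_std t_std sut ut.
  by exists k; [exact: ltnW|rewrite !nth_rcons -sut k_lt].
rewrite eqseq_rcons Eut eqxx /= => ab.
exists (size u); first by rewrite sut.
rewrite !nth_rcons sut ltnn eqxx; split=> //.
by apply: addable_dist; rewrite // -Eut.
Qed.

(** * Connecting the standard tableaux of one shape by exchanges *)

Inductive linked : seq int -> seq int -> Prop :=
  | linked_refl s : linked s s
  | linked_step i s t : (i.+1 < size s)%N -> (1 < `|ct s i - ct s i.+1|)%N ->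
      linked (swap i s) t -> linked s t.

Lemma linked_trans t s u : linked s t -> linked t u -> linked s u.
Proof.
move=> st; elim: st u => // i s' t' i_lt far _ IH u tu.
exact: linked_step i_lt far (IH u tu).
Qed.

Lemma swap_rcons i s c : (i.+1 < size s)%N -> swap i (rcons s c) = rcons (swap i s) c.
Proof.
elim: i s => [|i IHi] [|x s] //=; first by case: s.
by rewrite ltnS => /IHi ->.
Qed.

Lemma linked_rcons c s t : linked s t -> linked (rcons s c) (rcons t c).
Proof.
elim=> [s'|i s' t' i_lt far _ IH]; first exact: linked_refl.
apply: (@linked_step i); first by rewrite size_rcons ltnW.
  by rewrite !nth_rcons i_lt (ltnW i_lt).
by rewrite swap_rcons.
Qed.

Lemma linked_std s t : linked s t -> std s -> std t.
Proof. by elim=> // i s' t' i_lt far _ IH /(std_swap i_lt far). Qed.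

Lemma linked_move c s1 s2 : {in s2, forall x, (1 < `|(c - x)%R|)%N} ->
  linked (s1 ++ c :: s2) (rcons (s1 ++ s2) c).
Proof.
elim: s2 s1 => [|x s2 IHs] s1 far.
  by rewrite cats0 cats1; apply: linked_refl.
have E1 : ct (s1 ++ [:: c, x & s2]) (size s1) = c by rewrite nth_cat ltnn subnn.
have E2 : ct (s1 ++ [:: c, x & s2]) (size s1).+1 = x.
  by rewrite nth_cat ltnNge leqnSn subSnn.
apply: (@linked_step (size s1)); rewrite ?E1 ?E2.
- by rewrite size_cat /=; lia.
- by apply: far; rewrite mem_head.
rewrite swap_cat /= -!(cat_rcons x); apply: IHs => y ys2.
by apply: far; rewrite inE ys2 orbT.
Qed.

Lemma mem_split_last (T : eqType) (c : T) s : c \in s ->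
  exists s1 s2, s = s1 ++ c :: s2 /\ c \notin s2.
Proof.
elim: s => // x s IHs; have [/IHs[s1 [s2 [-> cs2]]]|cs] := boolP (c \in s).
  by exists (x :: s1), s2.
by rewrite inE (negPf cs) orbF => /eqP <-; exists [::], s.
Qed.

Lemma mult_cat s t c : mult (s ++ t) c = (mult s c + mult t c)%N.
Proof. exact: count_cat. Qed.

Lemma bit_rcons p c k : bit (rcons p c) k = bit p k + (c == k - 1)%:Z - (c == k)%:Z.
Proof. by rewrite -bit_cons; apply: bit_perm; rewrite perm_rcons. Qed.

(** Induction on the last entry c of [t]: the last c in [s] can be moved to the end by admissible
    exchanges, after which both words end in c. *)
Lemma std_linked s t : std s -> std t -> perm_eq s t -> linked s t.
Proof.
elim/last_ind: t s => [|t c IHt] s s_std t_std st.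
  by rewrite (perm_nilP st); apply: linked_refl.
have [s1 [s2 [Es cs2]]] : exists s1 s2, s = s1 ++ c :: s2 /\ c \notin s2.
  by apply: mem_split_last; rewrite (perm_mem st) mem_rcons mem_head.
have lk : linked s (rcons (s1 ++ s2) c).
  rewrite Es; apply: linked_move => x xs2.
  have xc : x != c by apply: contraNneq cs2 => <-.
  (* Right after the last c of [s] the steps at c and c+1 are 0 and 1. They are the same at the end,
     where the shape is that of [rcons t c]. As c does not recur, neither c-1 nor c+1 can occur in
     [s2]. *)
  have addable_bits p : std (rcons p c) ->
      (bit (rcons p c) c = 0) * (bit (rcons p c) (c + 1) = 1).
    rewrite std_rcons !bit_rcons => /andP[_ /andP[/eqP -> /eqP ->]].
    by split; lia.
  have s1_std : std (rcons s1 c) by move: s_std; rewrite Es -cat_rcons std_cat => /andP[].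
  have bit_s k : bit s k = bit (rcons s1 c) k + (mult s2 (k - 1))%:Z - (mult s2 k)%:Z.
    by rewrite Es -cat_rcons /bit !mult_cat; lia.
  have m0 : mult s2 c = 0 :> nat by apply/eqP; rewrite -leqn0 leqNgt mult_gt0.
  have := (bit_s c, bit_s (c + 1)); rewrite !(bit_perm st) !addable_bits // addrK m0.
  case=> E1 E2; rewrite -mult_gt0 in xs2.
  have xc1 : x <> c - 1 by move=> E; rewrite E in xs2; lia.
  have xc2 : x <> c + 1 by move=> E; rewrite E in xs2; lia.
  by lia.
have := linked_std lk s_std; rewrite std_rcons => /andP[s12_std _].
apply: (linked_trans lk); apply/linked_rcons/IHt => //.
  by move: t_std; rewrite std_rcons => /andP[].
rewrite -(perm_cons c) -(perm_rcons c) perm_sym -perm_rcons perm_sym.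
by rewrite (perm_trans _ st) // Es perm_rcons perm_sym perm_catC /= perm_cons perm_catC.
Qed.

(** * Counting standard tableaux *)

(** A finite list that contains every addable content: a box of nonzero content needs a neighbour of
    content one step nearer to 0. *)
Definition candidates (w : seq int) : seq int :=
  undup (0 :: [seq x + 1 | x <- w] ++ [seq x - 1 | x <- w]).

Definition addables w := [seq c <- candidates w | addable w c].

Definition removables m := [seq d <- undup m | addable (rem d m) d].

Fixpoint stds n : seq (seq int) :=
  if n is m.+1 then [seq rcons w c | w <- stds m, c <- addables w] else [:: [::]].

Lemma mem_shift (w : seq int) a c : (c \in [seq x + a | x <- w]) = (c - a \in w).
Proof.
apply/mapP/idP => [[x xw ->]|cw]; first by rewrite addrK.
by exists (c - a); rewrite ?subrK.
Qed.

Lemma mem_candidates w c :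
  (c \in candidates w) = [|| c == 0, c - 1 \in w | c + 1 \in w].
Proof.
by rewrite mem_undup inE mem_cat !mem_shift opprK.
Qed.

Lemma addable_candidate w c : addable w c -> c \in candidates w.
Proof.
rewrite mem_candidates; case: (ltgtP c 0) => //= c0 wc.
  by rewrite addable_nearN ?orbT.
by rewrite addable_near.
Qed.

Lemma mem_addables w c : (c \in addables w) = addable w c.
Proof. by rewrite mem_filter; case: (boolP (addable w c)) => // /addable_candidate ->. Qed.

Lemma addables_uniq w : uniq (addables w).
Proof. by rewrite filter_uniq ?undup_uniq. Qed.

Lemma removables_uniq w : uniq (removables w).
Proof. by rewrite filter_uniq ?undup_uniq. Qed.

Lemma bit_rem d m k : d \in m -> bit m k = bit (rem d m) k + (d == k - 1)%:Z - (d == k)%:Z.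
Proof. by move=> dm; rewrite -bit_cons; apply: bit_perm; apply: perm_to_rem. Qed.

Lemma mem_removables m d : bits01 m ->
  (d \in removables m) = (bit m d == 0) && (bit m (d + 1) == 1).
Proof.
move=> m01; rewrite mem_filter mem_undup.
have [dm|dm] /= := boolP (d \in m); last first.
  rewrite andbF; apply/esym/negbTE; move: dm (m01 d) (m01 (d + 1)).
  by rewrite -mult_gt0 /bit addrK; lia.
by rewrite andbT /addable !(bit_rem _ dm); lia.
Qed.

Lemma count_flips (b : nat -> bool) L :
  (count (fun i => b i && ~~ b i.+1) (iota 0 L) + b L =
   count (fun i => ~~ b i && b i.+1) (iota 0 L) + b 0)%N.
Proof.
elim: L => // L IHL; rewrite -addn1 iotaD !count_cat /= !add0n !addn0 addn1.
by move: IHL; case: (b L); case: (b L.+1); case: (b 0) => /=; lia.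
Qed.

(** Addable contents are the falls of the boundary path and removable ones its rises. The path
    begins with steps 1 and ends with steps 0, so it falls once more than it rises. Outside the
    window from -K to K it is that of the empty partition. *)
Lemma size_addables m : bits01 m -> size (addables m) = (size (removables m)).+1.
Proof.
move=> m01; have [K mK] : exists K, {in m, forall x, (`|x| < K)%N}.
  elim: (m) => [|x s [K sK]]; first by exists 0.
  exists (maxn K `|x|.+1) => y; rewrite inE => /predU1P[->|/sK]; lia.
have mK0 x : (K <= `|x|)%N -> mult m x = 0 :> nat.
  by case: (posnP (mult m x)) => //; rewrite mult_gt0 => /mK; lia.
pose pos (i : nat) : int := i%:Z - K%:Z; pose b i := bit m (pos i) == 1.
pose R := [seq pos i | i <- iota 0 (2 * K).+1].
have R_uniq : uniq R by rewrite map_inj_uniq ?iota_uniq // /pos => i j; lia.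
have memR x : (`|x| <= K)%N -> x \in R.
  move=> xK; apply/mapP; exists `|(x + K%:Z)%R|%N; rewrite ?mem_iota /pos; lia.
have posS i : pos i.+1 = pos i + 1 by rewrite /pos; lia.
have -> : size (addables m) = count (fun i => b i && ~~ b i.+1) (iota 0 (2 * K).+1).
  have /perm_size -> : perm_eq (addables m) [seq c <- R | addable m c].
    apply: uniq_perm; rewrite ?addables_uniq ?filter_uniq // => c.
    rewrite mem_addables mem_filter; case: (boolP (addable m c)) => //= mc.
    rewrite memR //; have := addable_candidate mc; rewrite mem_candidates.
    by case/or3P => [/eqP ->|/mK|/mK]; lia.
  rewrite size_filter count_map; apply: eq_count => i /=.
  by rewrite /addable /b posS; have := m01 (pos i + 1); lia.
have -> : size (removables m) = count (fun i => ~~ b i && b i.+1) (iota 0 (2 * K).+1).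
  have /perm_size -> : perm_eq (removables m)
      [seq c <- R | (bit m c == 0) && (bit m (c + 1) == 1)].
    apply: uniq_perm; rewrite ?removables_uniq ?filter_uniq // => c.
    rewrite [RHS]mem_filter -mem_removables //; case: (boolP (c \in _)) => //=.
    by rewrite mem_filter mem_undup => /andP[_ /mK cK]; rewrite memR //; lia.
  rewrite size_filter count_map; apply: eq_count => i /=.
  by rewrite /b posS; have := m01 (pos i); lia.
have b0 : b 0 by rewrite /b /bit !mK0 /pos; lia.
have bL : b (2 * K).+1 = false by rewrite /b /bit !mK0 /pos; lia.
by have := count_flips b (2 * K).+1; rewrite b0 bL; lia.
Qed.

Lemma mem_stds n w : (w \in stds n) = std w && (size w == n).
Proof.
elim: n w => [|n IHn] w; first by case: w => [|x w]; rewrite ?andbF.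
apply/allpairsPdep/andP => [[u [c []]]|[]].
  rewrite IHn mem_addables => /andP[u_std /eqP <-] uc ->.
  by rewrite std_rcons u_std uc size_rcons.
elim/last_ind: w => // w c _; rewrite std_rcons size_rcons => /andP[w_std wc] sw.
by exists w, c; rewrite IHn mem_addables w_std.
Qed.

Lemma stds_uniq n : uniq (stds n).
Proof.
elim: n => //= n IHn; apply: allpairs_uniq_dep => //.
  by move=> w _; apply: addables_uniq.
by move=> [w c] [w' c'] _ _ /= /rcons_inj[<- <-].
Qed.

Lemma big_stdsS (R : Type) (idx : R) (op : Monoid.com_law idx) n (f : seq int -> R) :
  \big[op/idx]_(t <- stds n.+1) f t =
  \big[op/idx]_(w <- stds n) \big[op/idx]_(c <- addables w) f (rcons w c).
Proof. exact: big_allpairs_dep. Qed.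

Definition nstd n (m : seq int) := count (perm_eq m) (stds n).

Lemma nstd_perm n (m m' : seq int) : perm_eq m m' -> nstd n m = nstd n m'.
Proof. by move=> mm'; apply: eq_count; apply/permPl. Qed.

Lemma perm_rcons_rem (m w : seq int) c :
  perm_eq m (rcons w c) = (c \in m) && perm_eq (rem c m) w.
Proof.
have [cm|cm] /= := boolP (c \in m); last first.
  by apply: contraNF cm => /perm_mem ->; rewrite mem_rcons mem_head.
by rewrite (permPl (perm_to_rem cm)) perm_sym perm_rcons perm_sym perm_cons.
Qed.

Lemma nstdS n m : nstd n.+1 m = (\sum_(d <- removables m) nstd n (rem d m))%N.
Proof.
rewrite /nstd -sum1_count big_mkcond big_stdsS.
under [RHS]eq_bigr do rewrite -sum1_count big_mkcond.
rewrite [RHS]exchange_big; apply: eq_bigr => w _.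
rewrite -!big_mkcond !sum1_count -!size_filter; apply: perm_size.
apply: uniq_perm; rewrite ?filter_uniq ?addables_uniq ?undup_uniq // => c.
rewrite [LHS]mem_filter mem_addables perm_rcons_rem !mem_filter mem_undup.
case: (boolP (c \in m)); rewrite ?andbF //= => _.
case: (boolP (perm_eq _ w)) => //= /(addable_perm) ->.
by rewrite andbT.
Qed.

(** Adding c and removing a different box d commute: the off-diagonal part of the relation DU - UD =
    1. *)
Lemma addable_exchange p c d : c != d ->
  addable (d :: p) c && addable (c :: p) d = addable p d && addable p c.
Proof.
rewrite /addable !bit_cons => cd.
have [E|dc1] := eqVneq d (c - 1).
  have -> : d + 1 = c by lia.
  by lia.
have [E|dc2] := eqVneq d (c + 1).
  rewrite -!E; lia.
by lia.
Qed.

Lemma removables_cons c m : addable m c ->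
  perm_eq (removables (c :: m))
    (c :: [seq d <- undup m | (d != c) && addable (c :: rem d m) d]).
Proof.
move=> mc; apply: uniq_perm; first exact: removables_uniq.
  by rewrite /= mem_filter eqxx filter_uniq ?undup_uniq.
move=> d; rewrite [RHS]inE [LHS]mem_filter [X in _ || X]mem_filter !mem_undup inE /=.
by case: eqVneq => [<-|_] /=; rewrite ?eqxx ?mc.
Qed.

(* This is [DU - UD = 1] for the Young lattice. *)
Lemma nstd_addables k m : bits01 m -> size m = k ->
  (\sum_(c <- addables m) nstd k.+1 (c :: m) = k.+1 * nstd k m)%N.
Proof.
elim: k m => [|k IHk] m m01 sm.
  rewrite (size0nil sm).
  have -> : addables [::] = [:: 0] by [].
  by rewrite big_seq1.
under eq_big_seq => c.
  rewrite mem_addables => mc.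
  rewrite nstdS (perm_big _ (removables_cons mc)) big_cons /= eqxx big_filter.
  under eq_bigr => d /andP[/negPf dc _] do rewrite eq_sym dc.
  over.
rewrite big_split /= big_const_seq count_predT iter_addn_0.
pose g d c := nstd k.+1 (c :: rem d m).
(* [Y] collects the contributions of adding c and removing d with c and d different, which do not
   depend on the order. The terms with c = d occur once per addable box in one order and once per
   removable box in the other. *)
pose Y := (\sum_(d <- removables m)
  \sum_(c <- candidates m | (c != d) && addable (rem d m) c) g d c)%N.
have -> : (\sum_(c <- addables m)
    \sum_(d <- undup m | (d != c) && addable (c :: rem d m) d) g d c = Y)%N.
  rewrite /addables big_filter big_mkcond /=.
  under eq_bigr => c _.
    rewrite big_mkcond /=; over.
  under eq_bigr => c _.
    have -> : (if addable m c then
        \sum_(d <- undup m) if (d != c) && addable (c :: rem d m) d then g d c else 0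
      else 0)%N = (\sum_(d <- undup m) if addable (rem d m) d then
        if (c != d) && addable (rem d m) c then g d c else 0 else 0)%N.
      case: ifP => mc; first apply: eq_big_seq => d; rewrite ?mem_undup.
        move=> dm; rewrite [d == c]eq_sym; case: eqVneq => [_|cd] /=; first by case: ifP.
        have := addable_exchange (rem d m) cd.
        rewrite -(addable_perm (perm_to_rem dm)) mc /= => ->.
        by case: (addable _ d); case: (addable _ c).
      rewrite big_seq big1 // => d; rewrite mem_undup => dm.
      case: ifP => // rd; case: ifP => // /andP[cd rc].
      have := addable_exchange (rem d m) cd.
      by rewrite -(addable_perm (perm_to_rem dm)) mc rd rc.
    over.
  rewrite exchange_big /Y /removables big_filter [RHS]big_mkcond.
  by apply: eq_bigr => d _; case: ifP => _; rewrite -?big_mkcond // big1.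
have EY : (Y + size (removables m) * nstd k.+1 m = k.+1 * nstd k.+1 m)%N.
  rewrite [in RHS]nstdS big_distrr /= mulnC -iter_addn_0.
  rewrite -(count_predT (removables m)) -big_const_seq -big_split /=.
  apply: eq_big_seq => d; rewrite mem_filter mem_undup => /andP[rd dm].
  have r01 : bits01 (rem d m).
    move=> x; have := m01 x; rewrite (bit_rem _ dm); case/andP: rd => /eqP r1 /eqP r0.
    have [<-|dx] := eqVneq d x; first by rewrite r1; right.
    have [dx1|_] := eqVneq d (x - 1); last by lia.
    have -> : x = d + 1 by lia.
    by rewrite r0; left.
  have sr : size (rem d m) = k by rewrite size_rem // sm.
  rewrite -(IHk _ r01 sr) (bigD1_seq d) ?addables_uniq ?mem_addables //= addnC.
  congr (_ + _)%N; first by apply: nstd_perm; apply: perm_to_rem.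
  rewrite -[RHS]big_filter -[LHS]big_filter; apply: perm_big; apply: uniq_perm.
  - by rewrite filter_uniq ?undup_uniq.
  - by rewrite filter_uniq ?addables_uniq.
  move=> c; rewrite [LHS]mem_filter [RHS]mem_filter mem_addables -andbA; congr (_ && _).
  case: (boolP (addable _ c)) => //= /addable_candidate.
  rewrite !mem_candidates => /or3P[->//|/mem_rem ->|/mem_rem ->]; by rewrite !orbT.
by rewrite size_addables //; nia.
Qed.

(** This is the sum of f^2 over shapes, since each shape occurs in the sum once per tableau. *)
Lemma sum_nstd n : (\sum_(t <- stds n) nstd n t = n`!)%N.
Proof.
elim: n => [|n IHn]; first by rewrite big_cons big_nil.
rewrite big_stdsS factS -IHn big_distrr /=; apply: eq_big_seq => w.
rewrite mem_stds => /andP[w_std /eqP sw].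
rewrite -nstd_addables ?(std_bits01 w_std) //; last exact: std_bits01.
by apply: eq_bigr => c _; apply: nstd_perm; rewrite perm_rcons.
Qed.

(** * The seminormal action *)

Section SeminormalAction.
Variables (F : fieldType) (q : F) (n : nat).
Hypothesis q_neq0 : q != 0.
Hypothesis qint_neq0 : forall k : nat, (1 <= k <= n)%N -> qint q k != 0.

Local Notation diag_coef := (diag_coef q).
Local Notation off_coef := (off_coef q).
Local Notation qintz := (qintz q).

Definition Tact i (phi : seq int -> F) w : F :=
  diag_coef (ct w i) (ct w i.+1) * phi w + off_coef (ct w i) (ct w i.+1) * phi (swap i w).

(* Meaningful only at standard tableaux: at other words the contents of adjacent
   boxes may coincide, and the Hecke relations fail. *)
Fixpoint hact (x : hecke_expr F n) (phi : seq int -> F) (w : seq int) : F :=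
  match x with
  | HCst c => c * phi w
  | HGen i => Tact i phi w
  | HAdd y z => hact y phi w + hact z phi w
  | HMul y z => hact y (hact z phi) w
  end.

Definition tableau w := std w && (size w == n).

Lemma gen_lt (i : 'I_n.-1) : (i.+1 < n)%N.
Proof. by case: (n) i => [|m] [i] //=. Qed.

Lemma tableau_qintz w i j : tableau w -> (i < n)%N -> (j < n)%N ->
  ct w i != ct w j -> qintz (ct w i) != qintz (ct w j).
Proof.
case/andP=> w_std /eqP sw i_n j_n ij; apply: (qintz_inj q_neq0 qint_neq0 ij).
by rewrite -sw ltnW // std_content_dist // mem_nth // sw.
Qed.

Lemma tableau_split w i : (i.+1 < n)%N -> tableau w ->
  exists s x y t, [/\ w = s ++ [:: x, y & t], size s = i & std_from s [:: x, y & t]].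
Proof.
move=> i_n /andP[w_std /eqP sw].
exists (take i w), (ct w i), (ct w i.+1), (drop i.+2 w).
have Ew : w = take i w ++ [:: ct w i, ct w i.+1 & drop i.+2 w].
  by apply: word_split; rewrite sw.
split=> //; first by rewrite size_takel // sw; apply/ltnW/ltnW.
by move: w_std; rewrite {1}Ew std_cat => /andP[].
Qed.

Lemma tableau_ct_neq w i : tableau w -> (i.+1 < n)%N ->
  qintz (ct w i) != qintz (ct w i.+1).
Proof.
move=> w_tab i_n; have [s [x [y [t [Ew ss /std_from_neq xy]]]]] := tableau_split i_n w_tab.
apply: tableau_qintz => //; first exact: ltnW.
by rewrite Ew !nth_cat ss ltnn leqNgt !ltnS leqnSn /= subnn subSnn.
Qed.

(** The purpose of the cut-off in [off_coef]: the action on tableaux never reads a value at a word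
    that is not one. *)
Lemma off_coef_tableau w i : tableau w -> (i.+1 < n)%N ->
  off_coef (ct w i) (ct w i.+1) = 0 \/ tableau (swap i w).
Proof.
move=> w_tab i_n; rewrite /off_coef; case: ltnP => [adj|_]; last by left.
right; case/andP: w_tab => w_std /eqP sw.
by rewrite /tableau size_swap sw eqxx std_swap // sw.
Qed.

Lemma hact_ext x phi psi : (forall w, tableau w -> phi w = psi w) ->
  forall w, tableau w -> hact x phi w = hact x psi w.
Proof.
elim: x phi psi => [c|i|x IHx y IHy|x IHx y IHy] phi psi E w w_tab /=.
- by rewrite E.
- rewrite /Tact E //; congr (_ + _).
  by have [->|/E ->//] := off_coef_tableau w_tab (gen_lt i); rewrite !mul0r.
- by rewrite (IHx _ _ E) // (IHy _ _ E).
- by apply: IHx => //; apply: IHy.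
Qed.

Lemma Tact_ext i phi psi : phi =1 psi -> Tact i phi =1 Tact i psi.
Proof. by move=> E w; rewrite /Tact !E. Qed.

Lemma hact_eq x phi psi : phi =1 psi -> hact x phi =1 hact x psi.
Proof.
elim: x phi psi => [c|i|x IHx y IHy|x IHx y IHy] phi psi E w /=.
- by rewrite E.
- exact: Tact_ext.
- by rewrite (IHx _ _ E) // (IHy _ _ E).
- by apply: IHx => //; apply: IHy.
Qed.

Lemma hact_linear x c phi psi :
  hact x (fun w => c * phi w + psi w) =1 fun w => c * hact x phi w + hact x psi w.
Proof.
elim: x phi psi => [d|i|x IHx y IHy|x IHx y IHy] phi psi w /=.
- by ring.
- by rewrite /Tact; ring.
- by rewrite IHx IHy; ring.
- by rewrite (hact_eq x (IHy phi psi)) IHx.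
Qed.

Lemma hact0 x w : hact x (fun=> 0) w = 0.
Proof.
rewrite -[RHS](addNr (hact x (fun=> 0) w)) -mulN1r -hact_linear.
by apply: hact_eq => u; rewrite mulr0 addr0.
Qed.

Lemma hactZ x c phi w : hact x (fun u => c * phi u) w = c * hact x phi w.
Proof.
rewrite -[RHS]addr0 -(hact0 x w) -hact_linear.
by apply: hact_eq => u; rewrite addr0.
Qed.

Lemma hactD x phi psi w :
  hact x (fun u => phi u + psi u) w = hact x phi w + hact x psi w.
Proof.
rewrite -[hact x phi w]mul1r -hact_linear.
by apply: hact_eq => u; rewrite mul1r.
Qed.

Lemma hact_sum x (I : Type) (r : seq I) (phi : I -> seq int -> F) w :
  hact x (fun u => \sum_(i <- r) phi i u) w = \sum_(i <- r) hact x (phi i) w.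
Proof.
elim: r => [|i r IHr].
  by rewrite big_nil -[RHS](hact0 x w); apply: hact_eq => u; rewrite big_nil.
rewrite big_cons -IHr -hactD; apply: hact_eq => u.
by rewrite big_cons.
Qed.

Lemma Tact_cat i phi s x y t : size s = i ->
  Tact i phi (s ++ [:: x, y & t]) =
  diag_coef x y * phi (s ++ [:: x, y & t]) + off_coef x y * phi (s ++ [:: y, x & t]).
Proof.
by move=> <-; rewrite /Tact swap_cat !nth_cat ltnn ltnNge leqnSn subnn subSnn.
Qed.

Lemma Tact_catS i phi s x y z t : size s = i ->
  Tact i.+1 phi (s ++ [:: x, y, z & t]) =
  diag_coef y z * phi (s ++ [:: x, y, z & t]) + off_coef y z * phi (s ++ [:: x, z, y & t]).
Proof.
by move=> ss; rewrite -!(cat_rcons x) Tact_cat // size_rcons ss.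
Qed.

Lemma Tact_quad i phi w : tableau w -> (i.+1 < n)%N ->
  Tact i (Tact i phi) w = (q - q^-1) * Tact i phi w + phi w.
Proof.
move=> w_tab i_n; have xy := tableau_ct_neq w_tab i_n.
have [s [x [y [t [Ew ss _]]]]] := tableau_split i_n w_tab.
move: xy; rewrite Ew !Tact_cat //.
rewrite !nth_cat -ss ltnn ltnNge leqnSn subnn subSnn /= => xy.
have E2 := diag_coef_sym q_neq0 xy; have E1 := off_coef_sym q_neq0 xy.
have -> : diag_coef y x = q - q^-1 - diag_coef x y by rewrite -E2; ring.
transitivity ((diag_coef x y ^+ 2 + off_coef x y * off_coef y x) * phi (s ++ [:: x, y & t])
   + off_coef x y * (q - q^-1) * phi (s ++ [:: y, x & t])); first by ring.
by rewrite E1; field.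
Qed.

Lemma Tact_comm i j phi w : (i.+1 < j)%N -> (j.+1 < size w)%N ->
  Tact i (Tact j phi) w = Tact j (Tact i phi) w.
Proof.
move=> ij jw; have iw : (i.+1 < size w)%N by lia.
rewrite /Tact !nth_swap // !(swap_comm w ij).
have -> : (j == i) = false by lia.
have -> : (j == i.+1) = false by lia.
have -> : (j.+1 == i) = false by lia.
have -> : (j.+1 == i.+1) = false by lia.
have -> : (i == j) = false by lia.
have -> : (i == j.+1) = false by lia.
have -> : (i.+1 == j) = false by lia.
have -> : (i.+1 == j.+1) = false by lia.
by ring.
Qed.

Lemma Tact_braid i phi w : tableau w -> (i.+2 < n)%N ->
  Tact i (Tact i.+1 (Tact i phi)) w = Tact i.+1 (Tact i (Tact i.+1 phi)) w.
Proof.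
move=> w_tab i_n; have [xy yz] := (tableau_ct_neq w_tab (ltnW i_n), tableau_ct_neq w_tab i_n).
have [s [x [y [t' [Ew ss st]]]]] := tableau_split (ltnW i_n) w_tab.
case: t' Ew st => [|z t] Ew st.
  case/andP: w_tab => _ /eqP sw; move: i_n; rewrite -sw Ew size_cat ss /=; lia.
have xz : qintz (ct w i) != qintz (ct w i.+2).
  apply: tableau_qintz => //; first by lia.
  rewrite Ew !nth_cat ss ltnn subnn; have -> : (i.+2 < i)%N = false by lia.
  have -> : (i.+2 - i = 2)%N by lia.
  exact: std_from_neq13 st.
move: xy yz xz; have -> : ct w i = x by rewrite Ew nth_cat ss ltnn subnn.
have -> : ct w i.+1 = y.
  by rewrite Ew nth_cat ss; have -> : (i.+1 < i)%N = false by [lia]; rewrite subSnn.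
have -> : ct w i.+2 = z.
  rewrite Ew nth_cat ss; have -> : (i.+2 < i)%N = false by lia.
  by have -> : (i.+2 - i = 2)%N by lia.
move=> xy yz xz; rewrite Ew.
do ! rewrite ?(Tact_cat _ _ _ _ ss) ?(Tact_catS _ _ _ _ _ ss).
have D := diag_coef_braid q_neq0 xy yz xz.
have Y1 := diag_coef_yang_baxter q_neq0 xy yz xz.
have Y2 := diag_coef_yang_baxter2 q_neq0 xy yz xz.
apply/eqP; rewrite -subr_eq0; apply/eqP.
set p1 := phi (s ++ [:: x, y, z & t]); set p2 := phi (s ++ [:: y, x, z & t]).
set p3 := phi (s ++ [:: x, z, y & t]).
transitivity (
  ((diag_coef x y ^+ 2 * diag_coef y z + off_coef x y * off_coef y x * diag_coef x z) -
   (diag_coef y z ^+ 2 * diag_coef x y + off_coef y z * off_coef z y * diag_coef x z)) * p1 +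
  ((diag_coef x y * diag_coef y z + diag_coef x z * diag_coef y x) -
   diag_coef y z * diag_coef x z) * (off_coef x y * p2) -
  ((diag_coef x y * diag_coef y z + diag_coef x z * diag_coef z y) -
   diag_coef x y * diag_coef x z) * (off_coef y z * p3)).
  by ring.
by rewrite D Y1 Y2 !subrr !mul0r addr0 oppr0 addr0.
Qed.

Lemma hecke_eq_hact x y : hecke_eq q x y ->
  forall phi w, tableau w -> hact x phi w = hact y phi w.
Proof.
elim=> {x y} /=.
- by [].
- by move=> x y _ IH phi w w_tab; rewrite IH.
- by move=> x y z _ IH1 _ IH2 phi w w_tab; rewrite IH1 // IH2.
- by move=> x x' y y' _ IHx _ IHy phi w w_tab; rewrite IHx // IHy.
- move=> x x' y y' _ IHx _ IHy phi w w_tab; rewrite IHx //.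
  by apply: hact_ext => // u u_tab; apply: IHy.
- by move=> x y z phi w _; rewrite addrA.
- by move=> x y phi w _; rewrite addrC.
- by move=> x phi w _; rewrite mul0r add0r.
- by move=> x phi w _; rewrite mulN1r addNr mul0r.
- by [].
- by move=> x phi w _; rewrite mul1r.
- by [].
- by move=> x y z phi w _; rewrite hactD.
- by move=> a b phi w _; rewrite mulrDl.
- by move=> a b phi w _; rewrite mulrA.
- by move=> a x phi w _; rewrite hactZ.
- move=> i phi w w_tab; have i_n := gen_lt i.
  have E : Tact i (fun u => Tact i phi u + q^-1 * phi u) w =
      Tact i (Tact i phi) w + q^-1 * Tact i phi w by rewrite /Tact; ring.
  by rewrite E Tact_quad //; field.
- move=> i j ij phi w /andP[_ /eqP sw]; rewrite Tact_comm // sw; exact: gen_lt.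
- move=> i j ij phi w w_tab; rewrite ij Tact_braid // -ij; exact: gen_lt.
Qed.

(** Only the values at tableaux are independent of the representative. *)
Definition haction (a : hecke q n) := hact (repr a).

Lemma haction_class x phi w : tableau w -> haction (hclass q x) phi w = hact x phi w.
Proof. by apply: hecke_eq_hact; apply: hclass_repr. Qed.

Lemma haction_ext a phi psi : (forall w, tableau w -> phi w = psi w) ->
  forall w, tableau w -> haction a phi w = haction a psi w.
Proof. exact: hact_ext. Qed.

Lemma haction1 phi w : tableau w -> haction 1 phi w = phi w.
Proof. by move=> w_tab; rewrite haction_class //= mul1r. Qed.

Lemma hactionD a b phi w : tableau w ->
  haction (a + b) phi w = haction a phi w + haction b phi w.
Proof.
elim/hclass_ind: a => x; elim/hclass_ind: b => y w_tab.
by rewrite hclassD !haction_class.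
Qed.

Lemma hactionM a b phi w : tableau w ->
  haction (a * b) phi w = haction a (haction b phi) w.
Proof.
elim/hclass_ind: a => x; elim/hclass_ind: b => y w_tab.
rewrite hclassM !haction_class //=; apply: hact_ext => // u u_tab.
by rewrite haction_class.
Qed.

Lemma hactionZ c a phi w : tableau w -> haction (c *: a) phi w = c * haction a phi w.
Proof.
by elim/hclass_ind: a => x w_tab; rewrite hclassZ hclassM !haction_class.
Qed.

Lemma hactionB a b phi w : tableau w ->
  haction (a - b) phi w = haction a phi w - haction b phi w.
Proof. by move=> w_tab; rewrite -scaleN1r hactionD // hactionZ // mulN1r. Qed.

Lemma haction_hT i phi w : tableau w -> haction (hT q i) phi w = Tact i phi w.
Proof. exact: haction_class. Qed.

Lemma haction_sum (I : Type) (r : seq I) (a : I -> hecke q n) phi w : tableau w ->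
  haction (\sum_(i <- r) a i) phi w = \sum_(i <- r) haction (a i) phi w.
Proof.
move=> w_tab; elim: r => [|i r IHr]; last by rewrite !big_cons hactionD ?IHr.
by rewrite !big_nil -(subrr 1) hactionB // subrr.
Qed.

End SeminormalAction.

(** * Matrix units from the Jucys-Murphy elements *)

Section MatrixUnits.
Variables (F : fieldType) (q : F) (n : nat).
Hypothesis q_neq0 : q != 0.
Hypothesis qint_neq0 : forall k : nat, (1 <= k <= n)%N -> qint q k != 0.

Local Notation diag_coef := (diag_coef q).
Local Notation off_coef := (off_coef q).
Local Notation qintz := (qintz q).
Local Notation hecke := (hecke q n).
Local Notation tableau := (tableau n).
Local Notation Tact := (Tact q).
Local Notation hactionM := (hactionM q_neq0 qint_neq0).
Local Notation hactionD := (hactionD q_neq0 qint_neq0).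
Local Notation hactionB := (hactionB q_neq0 qint_neq0).
Local Notation hactionZ := (hactionZ q_neq0 qint_neq0).
Local Notation haction1 := (haction1 q_neq0 qint_neq0).
Local Notation haction_sum := (haction_sum q_neq0 qint_neq0).
Local Notation haction_hT := (haction_hT q_neq0 qint_neq0).

Lemma mem_tableaux w : (w \in stds n) = tableau w.
Proof. exact: mem_stds. Qed.

(* 0 out of range *)
Definition gen k : hecke := if insub k is Some i then hT q i else 0.

Lemma haction_gen k phi w : (k.+1 < n)%N -> tableau w ->
  haction (gen k) phi w = Tact k phi w.
Proof.
move=> k_n w_tab; rewrite /gen insubT; first by case: (n) k_n.
by move=> lt_k; rewrite haction_hT.
Qed.

(* The Jucys-Murphy elements, additively normalised so that they also separate
   contents when q^2 = 1 *)
Fixpoint jucys_murphy k : hecke :=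
  if k is k'.+1 then gen k' * jucys_murphy k' * gen k' + gen k' else 0.

Lemma tableau_swap w i : tableau w -> (i.+1 < n)%N ->
  ct (swap i w) i = ct w i.+1 /\ ct (swap i w) i.+1 = ct w i.
Proof.
case/andP => _ /eqP sw i_n; rewrite !nth_swap ?sw // !eqxx.
by have -> : (i.+1 == i) = false by lia.
Qed.

Lemma haction_jucys_murphy k phi w : (k < n)%N -> tableau w ->
  haction (jucys_murphy k) phi w = qintz (ct w k) * phi w.
Proof.
elim: k phi w => [|k IHk] phi w k_n w_tab /=.
  rewrite -(subrr 1) hactionB // subrr.
  case/andP: w_tab => + /eqP sw; case: w sw => [|x w] sw; first by rewrite -sw in k_n.
  case/andP=> + _; rewrite /addable !bit_nil => x0.
  have -> /= : x = 0 by lia.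
  by rewrite qint0 mul0r.
have xy := tableau_ct_neq q_neq0 qint_neq0 w_tab k_n.
rewrite hactionD // !hactionM // !haction_gen //.
set L := haction (jucys_murphy k) _.
have EL u : tableau u -> L u = qintz (ct u k) * Tact k phi u.
  by move=> u_tab; rewrite /L IHk ?haction_gen // ltnW.
rewrite {1}/Tact EL //.
have [s1 s2] := tableau_swap w_tab k_n.
set x := ct w k; set y := ct w k.+1.
(* The formula for [L] holds at tableaux only, so the factor [off_coef] is kept: it vanishes when
   the exchanged word is not a tableau. *)
have -> : off_coef x y * L (swap k w) =
    off_coef x y * (qintz y * (diag_coef y x * phi (swap k w) + off_coef y x * phi w)).
  have [->|sw_tab] := off_coef_tableau q w_tab k_n; first by rewrite !mul0r.
  by rewrite EL // /Tact s1 s2 swapK.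
rewrite /Tact -/x -/y.
transitivity ((diag_coef x y ^+ 2 * qintz x + off_coef x y * off_coef y x * qintz y +
   diag_coef x y) * phi w +
  off_coef x y * (diag_coef x y * qintz x + diag_coef y x * qintz y + 1) *
   phi (swap k w)); first by ring.
by rewrite (diag_coef_diag q_neq0 xy) (diag_coef_offdiag q_neq0 xy) mulr0 mul0r addr0.
Qed.

Lemma tableau_separated u t : tableau u -> tableau t -> u != t ->
  exists2 k, (k < n)%N & qintz (ct u k) != qintz (ct t k).
Proof.
move=> /andP[u_std /eqP su] /andP[t_std /eqP st] ut.
have [|k k_n [ct_ut dist_ut]] := std_diff u_std t_std _ ut; first by rewrite su st.
rewrite su in k_n; exists k => //; apply: (qintz_inj q_neq0 qint_neq0 ct_ut).
exact: leq_trans dist_ut k_n.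
Qed.

Definition is_matrix_unit (s t : seq int) (h : hecke) :=
  forall phi w, tableau w -> haction h phi w = (w == s)%:R * phi t.

(** Lagrange interpolation: for each other tableau u, one factor (L_k - [ct u k])/([ct t k] -
    [ct u k]), with k a box at which the eigenvalues differ. *)
Lemma diag_matrix_unit t : tableau t -> exists h, is_matrix_unit t t h.
Proof.
move=> t_tab.
suff [h [g [hg gt g0]]] : exists (h : hecke) (g : seq int -> F),
    [/\ forall phi w, tableau w -> haction h phi w = g w * phi w, g t = 1 &
     {in stds n, forall u, u != t -> g u = 0}].
  exists h => phi w w_tab; rewrite hg //.
  by have [->|wt] := eqVneq w t; [rewrite gt|rewrite g0 ?mem_tableaux // !mul0r].
have : {subset stds n <= tableau} by move=> u; rewrite mem_tableaux.
elim: (stds n) => [|u r IHr] r_tab.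
  by exists 1, (fun=> 1); split=> // phi w w_tab; rewrite haction1 // mul1r.
have [|h [g [hg gt g0]]] := IHr; first by move=> v vr; apply: r_tab; rewrite inE vr orbT.
have [->|ut] := eqVneq u t.
  by exists h, g; split=> // v; rewrite inE => /predU1P[->|/g0//]; rewrite eqxx.
have [|k k_n utk] := tableau_separated _ t_tab ut; first by apply: r_tab; rewrite mem_head.
pose c := (qintz (ct t k) - qintz (ct u k))^-1.
exists ((c *: (jucys_murphy k - (qintz (ct u k)) *: 1)) * h).
exists (fun w => c * (qintz (ct w k) - qintz (ct u k)) * g w); split.
- move=> phi w w_tab; rewrite hactionM // hactionZ // hactionB // hactionZ // haction1 //.
  by rewrite haction_jucys_murphy // hg //; ring.
- by rewrite gt mulr1 /c mulVf // subr_eq0 eq_sym.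
move=> v; rewrite inE => /predU1P[->|vr] vt; first by rewrite subrr mulr0 mul0r.
by rewrite g0 ?mulr0.
Qed.

Lemma matrix_unit_mul s t u h h' : tableau t ->
  is_matrix_unit s t h -> is_matrix_unit t u h' -> is_matrix_unit s u (h * h').
Proof.
move=> t_tab st tu phi w w_tab.
by rewrite hactionM // st // tu // eqxx mul1r.
Qed.

(** Between the two diagonal units, T_i leaves only its exchange coefficient, which is invertible
    for contents at distance at least 2. *)
Lemma swap_matrix_unit s i : tableau s -> (i.+1 < n)%N ->
  (1 < `|(ct s i - ct s i.+1)%R|)%N -> exists h, is_matrix_unit s (swap i s) h.
Proof.
move=> s_tab i_n far; have [hs hsP] := diag_matrix_unit s_tab.
case/andP: (s_tab) => s_std /eqP sz.
have sw_tab : tableau (swap i s) by rewrite /tableau size_swap sz eqxx std_swap // sz.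
have [ht htP] := diag_matrix_unit sw_tab.
have b0 : off_coef (ct s i) (ct s i.+1) != 0.
  apply: (off_coef_neq0 q_neq0 qint_neq0); rewrite far -[X in (_ < X)%N]sz.
  by rewrite std_content_dist // mem_nth // sz // ltnW.
have ss : (s == swap i s) = false.
  apply/eqP => E; have [+ _] := tableau_swap s_tab i_n; rewrite -E => E'.
  by rewrite E' subrr in far.
exists ((off_coef (ct s i) (ct s i.+1))^-1 *: (hs * (gen i * ht))) => phi w w_tab.
rewrite hactionZ // hactionM // hsP // hactionM // haction_gen // /Tact.
 rewrite !htP // ss eqxx; rewrite mul0r mulr0 add0r mul1r mulrCA mulKf //.
Qed.

Lemma matrix_unit s t : tableau s -> tableau t -> perm_eq s t ->
  exists h, is_matrix_unit s t h.
Proof.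
move=> s_tab /andP[t_std _] st; have /andP[s_std _] := s_tab.
elim: (std_linked s_std t_std st) s_tab => [s' s_tab|i s' t' i_lt far _ IH s_tab].
  exact: diag_matrix_unit.
have sz : size s' = n by case/andP: s_tab => _ /eqP.
have sw_tab : tableau (swap i s').
  by case/andP: s_tab => s_std' _; rewrite /tableau size_swap sz eqxx std_swap.
rewrite sz in i_lt; have [h hP] := IH sw_tab.
have [h' h'P] := swap_matrix_unit s_tab i_lt far.
by exists (h' * h); apply: matrix_unit_mul h'P hP.
Qed.

Definition mcoef (a : hecke) (s t : seq int) : F :=
  haction a (fun w => (w == t)%:R) s.

Lemma haction_mcoef a phi s : tableau s ->
  haction a phi s = \sum_(t <- stds n) mcoef a s t * phi t.
Proof.
move=> s_tab.
transitivity (haction a (fun u => \sum_(t <- stds n) phi t * (u == t)%:R) s).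
  apply: haction_ext => // u u_tab.
  rewrite (bigD1_seq u) ?stds_uniq ?mem_tableaux //= eqxx mulr1 big1 ?addr0 // => t.
  by rewrite eq_sym => /negPf ->; rewrite mulr0.
by rewrite /haction hact_sum; apply: eq_bigr => t _; rewrite hactZ mulrC.
Qed.

Lemma mcoef_linear c a b s t : tableau s ->
  mcoef (c *: a + b) s t = c * mcoef a s t + mcoef b s t.
Proof. by move=> s_tab; rewrite /mcoef hactionD // hactionZ. Qed.

Lemma mcoef1 s t : tableau s -> mcoef 1 s t = (s == t)%:R.
Proof. by move=> s_tab; rewrite /mcoef haction1. Qed.

Lemma mcoefM a b s t : tableau s ->
  mcoef (a * b) s t = \sum_(u <- stds n) mcoef a s u * mcoef b u t.
Proof. by move=> s_tab; rewrite /mcoef hactionM // haction_mcoef. Qed.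

(** Exchanges permute a word, so functions that vanish on the tableaux of a given shape form a
    stable subspace. *)
Lemma mcoef_block a s t : tableau s -> ~~ perm_eq s t -> mcoef a s t = 0.
Proof.
move=> s_tab st; rewrite /mcoef /haction.
suff H (x : hecke_expr F n) (phi : seq int -> F) :
    (forall w, tableau w -> perm_eq s w -> phi w = 0) ->
    forall w, tableau w -> perm_eq s w -> hact q x phi w = 0.
  apply: H => // w _ sw; have [wt|//] := eqVneq w t.
  by rewrite -wt sw in st.
elim: x phi => [c|i|x IHx y IHy|x IHx y IHy] phi phi0 w w_tab sw /=.
- by rewrite phi0 ?mulr0.
- rewrite /Tact phi0 // mulr0 add0r.
  have [->|sw_tab] := off_coef_tableau q w_tab (gen_lt i); first by rewrite mul0r.
  rewrite phi0 ?mulr0 // (perm_trans sw) // perm_sym; exact: perm_swap.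
- by rewrite IHx // IHy ?addr0.
- by apply: IHx => // u u_tab su; apply: IHy.
Qed.

Lemma mcoef_surj (M : seq int -> seq int -> F) :
  (forall s t, tableau s -> tableau t -> ~~ perm_eq s t -> M s t = 0) ->
  exists a, forall s t, tableau s -> tableau t -> mcoef a s t = M s t.
Proof.
move=> M0.
have E (st : seq int * seq int) : exists h : hecke,
    tableau st.1 -> tableau st.2 -> perm_eq st.1 st.2 -> is_matrix_unit st.1 st.2 h.
  have [s_tab|] := boolP (tableau st.1); last by exists 0.
  have [t_tab|] := boolP (tableau st.2); last by exists 0.
  have [st_perm|] := boolP (perm_eq st.1 st.2); last by exists 0.
  by have [h hP] := matrix_unit s_tab t_tab st_perm; exists h.
have [h hP] := boolp.choice E.
exists (\sum_(s <- stds n) \sum_(t <- stds n) M s t *: h (s, t)) => s t s_tab t_tab.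
rewrite /mcoef haction_sum // (bigD1_seq s) ?stds_uniq ?mem_tableaux //=.
have term s' t' : tableau s' -> tableau t' ->
    haction (M s' t' *: h (s', t')) (fun w => (w == t)%:R) s =
    M s' t' * ((s == s')%:R * (t' == t)%:R).
  move=> s'_tab t'_tab; rewrite hactionZ //.
  have [st'|/M0 ->//] := boolP (perm_eq s' t'); last by rewrite !mul0r.
  by rewrite (hP (s', t')).
rewrite [X in _ + X]big_seq_cond [X in _ + X]big1 ?addr0 => [|s' /andP[]]; last first.
  rewrite mem_tableaux => s'_tab s's; rewrite haction_sum // big_seq big1 // => t'.
  by rewrite mem_tableaux => t'_tab; rewrite term // eq_sym (negPf s's) mul0r mulr0.
rewrite haction_sum // (bigD1_seq t) ?stds_uniq ?mem_tableaux //=.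
rewrite term // !eqxx !mulr1 [X in _ + X]big_seq_cond [X in _ + X]big1 ?addr0 // => t' /andP[].
by rewrite mem_tableaux => t'_tab tt'; rewrite term // (negPf tt') !mulr0.
Qed.

End MatrixUnits.

(** * The Hecke algebra is spanned by n! elements *)

Section Spanning.
Variables (F : fieldType) (q : F) (n : nat).
Hypothesis q_neq0 : q != 0.

Local Notation hecke := (hecke q n).
Local Notation gen := (@gen F q n).

Lemma hclass_cst c : hclass q (HCst c) = c *: (1 : hecke).
Proof. by rewrite -[LHS]mulr1 -hclassZ. Qed.

Lemma hT_quad (i : 'I_n.-1) : hT q i * hT q i = 1 + (q - q^-1) *: hT q i.
Proof.
have /hclassP := heq_quad q i.
rewrite -!hclassM -!hclassD -/(hT q i).
rewrite !hclass_cst scale0r mulrDl !mulrDr -!scalerAl -!scalerAr !mul1r !mulr1.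
rewrite scalerA mulNr mulfV // scaleN1r scaleNr => E.
apply/eqP; rewrite -subr_eq0 -{}E scalerBl opprD opprB -addrA; apply/eqP.
by congr (_ + _); rewrite [RHS]addrA [RHS]addrC.
Qed.

Lemma gen_quad k : (k.+1 < n)%N -> gen k * gen k = 1 + (q - q^-1) *: gen k.
Proof.
move=> k_n; rewrite /gen insubT; first by case: (n) k_n.
by move=> lt_k; apply: hT_quad.
Qed.

Lemma gen_comm i j : (i.+1 < j)%N -> gen i * gen j = gen j * gen i.
Proof.
rewrite /gen => ij; case: insubP => [i' _ Ei|_]; last by rewrite mul0r mulr0.
case: insubP => [j' _ Ej|_]; last by rewrite mul0r mulr0.
by rewrite /hT !hclassM; apply/hclassP/heq_comm; rewrite Ei Ej.
Qed.

Lemma gen_braid i : gen i * gen i.+1 * gen i = gen i.+1 * gen i * gen i.+1.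
Proof.
rewrite /gen; case: insubP => [i' _ Ei|_]; last by rewrite !(mul0r, mulr0).
case: insubP => [j' _ Ej|_]; last by rewrite !(mul0r, mulr0).
by rewrite /hT !hclassM; apply/hclassP/heq_braid; rewrite Ei Ej.
Qed.

Inductive span (r : seq hecke) : hecke -> Prop :=
  | span0 : span r 0
  | span_mem x : x \in r -> span r x
  | span_lin c x y : span r x -> span r y -> span r (c *: x + y).

Lemma spanZ r c x : span r x -> span r (c *: x).
Proof. by move=> rx; rewrite -[_ *: _]addr0; apply: span_lin => //; apply: span0. Qed.

Lemma spanD r x y : span r x -> span r y -> span r (x + y).
Proof. by move=> rx; rewrite -[x]scale1r; apply: span_lin. Qed.

Lemma span_mulr r s y : {in r, forall x, span s (x * y)} ->
  forall x, span r x -> span s (x * y).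
Proof.
move=> rs x; elim=> [|{}x /rs //|c {}x z _ IHx _ IHz]; first by rewrite mul0r; apply: span0.
by rewrite mulrDl -scalerAl; apply: span_lin.
Qed.

(* The words [down k m] with [m <= k] lift the distinguished coset
   representatives of S_k in S_{k+1}. *)
Fixpoint down k m : hecke := if m is m'.+1 then down k m' * gen (k - m)%N else 1.

Fixpoint hecke_basis k : seq hecke :=
  if k is k'.+1 then [seq b * down k' m | b <- hecke_basis k', m <- iota 0 k] else [:: 1].

Lemma size_hecke_basis k : size (hecke_basis k) = k`!.
Proof. by elim: k => // k IHk; rewrite size_allpairs IHk size_iota factS mulnC. Qed.

Lemma down_comm k m i : (i.+1 < k - m)%N -> down k m * gen i = gen i * down k m.
Proof.
elim: m => [|m IHm] i_lt /=; first by rewrite mul1r mulr1.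
by rewrite -mulrA -gen_comm // mulrA IHm ?mulrA //; lia.
Qed.

(** [down k m] is the descending product of the generators from k-1 to k-m; the generator i+1 passes
    through its factors i+1 and i by the braid relation and commutes with the others. *)
Lemma down_shift k m i : (m <= k)%N -> (k - m <= i)%N -> (i.+1 < k)%N ->
  down k m * gen i.+1 = gen i * down k m.
Proof.
elim: m => [|m IHm] m_k i_ge i_lt /=; first by lia.
have [Ei|i_neq] := eqVneq i (k - m.+1)%N; last first.
  by rewrite -mulrA gen_comm ?mulrA ?IHm ?mulrA //; lia.
case: m IHm m_k i_ge Ei => [|m] _ m_k i_ge Ei; first by lia.
have Ei1 : i.+1 = (k - m.+1)%N by lia.
by rewrite /= -Ei -Ei1 -!mulrA (mulrA (gen i.+1)) -gen_braid !mulrA down_comm //; lia.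
Qed.

(** Against [down k m], the generator i commutes if i < k-m-1, lengthens the word if i = k-m-1,
    meets its equal and is reduced by the quadratic relation if i = k-m, and becomes i-1 on the left
    if i > k-m. *)
Lemma span_gen k i : (k <= n)%N -> (i.+1 < k)%N ->
  forall x, span (hecke_basis k) x -> span (hecke_basis k) (x * gen i).
Proof.
elim: k i => // k IHk i k_n i_k; apply: span_mulr => _ /allpairsP[[b m] [bk m_k ->]].
rewrite mem_iota /= ltnS in bk m_k *.
have mem_down b' m' : b' \in hecke_basis k -> (m' <= k)%N ->
    span (hecke_basis k.+1) (b' * down k m').
  by move=> b'k m'_k; apply/span_mem/allpairs_f => //; rewrite mem_iota.
have span_down m' x : (m' <= k)%N -> span (hecke_basis k) x ->
    span (hecke_basis k.+1) (x * down k m').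
  by move=> m'_k; apply: span_mulr => y yk; apply: mem_down.
have [lt_i|gt_i|Ei] := ltngtP i (k - m); rewrite -mulrA.
- have [lt_i1|Ei] : (i.+1 < k - m)%N \/ i = (k - m.+1)%N by lia.
    rewrite down_comm // mulrA; apply: span_down => //; apply: IHk; try lia.
    exact: span_mem.
  by rewrite Ei -/(down k m.+1); apply: mem_down => //; lia.
- case: i i_k gt_i => // i i_k gt_i.
  rewrite down_shift //; try lia.
  rewrite mulrA; apply: span_down => //; apply: IHk; try lia.
  exact: span_mem.
case: m m_k Ei => [|m] m_k Ei; first by lia.
rewrite /= -Ei -mulrA gen_quad ?mulrDr ?mulr1; last by lia.
apply: spanD; first by apply: mem_down => //; lia.
by rewrite -scalerAr -scalerAr Ei -/(down k m.+1); apply/spanZ/mem_down.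
Qed.

Lemma mem1_hecke_basis k : 1 \in hecke_basis k.
Proof.
elim: k => [|k IHk]; first exact: mem_head.
by rewrite -[1]mulr1; apply/allpairsP; exists (1, 0); rewrite mem_iota.
Qed.

Lemma hecke_span a : span (hecke_basis n) a.
Proof.
elim/hclass_ind: a => x; rewrite -[hclass _ _]mul1r.
(* The element 1 is generalised to any [a] in the span, so that products can be absorbed factor by
   factor from the right. *)
move: (span_mem (mem1_hecke_basis n)); elim: x 1 => [c|i|x IHx y IHy|x IHx y IHy] a na.
- by rewrite hclass_cst -scalerAr mulr1; apply: spanZ.
- have -> : hclass q (HGen i) = gen i by rewrite /gen valK.
  by apply: span_gen => //; apply: gen_lt.
- by rewrite -hclassD mulrDr; apply: spanD; [apply: IHx|apply: IHy].
by rewrite -hclassM mulrA; apply/IHy/IHx.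
Qed.

Lemma span_coord r a : span r a ->
  exists v : 'I_(size r) -> F, a = \sum_i v i *: r`_i.
Proof.
elim=> [|x xr|c x y _ [v ->] _ [w ->]].
- by exists (fun=> 0); rewrite big1 // => i _; rewrite scale0r.
- have i_lt : (index x r < size r)%N by rewrite index_mem.
  exists (fun i => (i == Ordinal i_lt)%:R).
  rewrite (bigD1 (Ordinal i_lt)) //= eqxx scale1r nth_index // big1 ?addr0 // => i.
  by move=> /negPf ->; rewrite scale0r.
exists (fun i => c * v i + w i); rewrite scaler_sumr -big_split /=.
by apply: eq_bigr => i _; rewrite scalerDl scalerA.
Qed.

Hypothesis qint_neq0 : forall k : nat, (1 <= k <= n)%N -> qint q k != 0.

Local Notation tableau := (tableau n).

(** [M] expresses the coefficients of n! spanning elements at pairs of tableaux of equal shape.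
    There are n! such pairs, so [M] is square; it has full rank by [mcoef_surj], hence no kernel. *)
Lemma mcoef_inj (a : hecke) :
  (forall s t, tableau s -> tableau t -> mcoef a s t = 0) -> a = 0.
Proof.
pose P := [seq (s, t) | s <- stds n, t <- [seq t <- stds n | perm_eq s t]].
have sP : size P = n`!.
  rewrite size_allpairs_dep sumnE big_map -sum_nstd.
  by apply: eq_bigr => s _; rewrite size_filter.
have memP s t : (s, t) \in P = [&& tableau s, tableau t & perm_eq s t].
  apply/allpairsPdep/and3P => [[s' [t' []]]|[s_tab t_tab st]].
    rewrite mem_filter !mem_tableaux => s'_tab /andP[st' t'_tab] [-> ->].
    by [].
  by exists s, t; rewrite mem_filter !mem_tableaux st.
have P_uniq : uniq P.
  apply: allpairs_uniq_dep => [|s _|[s t] [s' t'] _ _ /= [-> ->]//].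
    exact: stds_uniq.
  by rewrite filter_uniq // stds_uniq.
set r := hecke_basis n.
pose p0 : seq int * seq int := ([::], [::]).
have P_tab (j : 'I_(size P)) : tableau (nth p0 P j).1 /\ tableau (nth p0 P j).2.
  have := mem_nth p0 (ltn_ord j); case: (nth p0 P j) => s t.
  by rewrite memP => /and3P[].
pose M : 'M[F]_(size r, size P) :=
  \matrix_(i, j) mcoef r`_i (nth p0 P j).1 (nth p0 P j).2.
have coefE (v : 'I_(size r) -> F) (j : 'I_(size P)) :
    mcoef (\sum_i v i *: r`_i) (nth p0 P j).1 (nth p0 P j).2 = (\row_i v i *m M) 0 j.
  have [j1 _] := P_tab j.
  rewrite /mcoef (haction_sum q_neq0 qint_neq0) // mxE; apply: eq_bigr => i _.
  by rewrite !mxE (hactionZ q_neq0 qint_neq0).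
have M_full : row_full M.
  apply/row_fullP.
  have /fin_all_exists[B BP] (j : 'I_(size P)) : exists v : 'rV_(size r), v *m M = delta_mx 0 j.
    have [|b bP] := mcoef_surj q_neq0 qint_neq0
        (M := fun s t => ((s, t) == nth p0 P j)%:R).
      move=> s t s_tab t_tab st; case: eqP => // E; have := mem_nth p0 (ltn_ord j).
      by rewrite -E memP (negPf st) !andbF.
    have [v Ev] := span_coord (hecke_span b).
    exists (\row_i v i); apply/rowP => k.
    have [k1 k2] := P_tab k.
    rewrite -coefE -Ev bP // mxE eqxx /= -surjective_pairing nth_uniq //.
  exists (\matrix_j B j); apply/row_matrixP => j.
  by rewrite row_mul rowK BP row1.
have M_free : row_free M.
  by move: M_full; rewrite /row_free /row_full => /eqP ->; rewrite sP size_hecke_basis.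
have [v ->] := span_coord (hecke_span a) => a0.
have v0 : \row_i v i = 0.
  apply: (row_free_inj M_free); rewrite mul0mx; apply/rowP => j.
  by have [j1 j2] := P_tab j; rewrite -coefE a0 // mxE.
rewrite big1 // => i _; have := congr1 (fun w : 'rV_(size r) => w 0 i) v0.
by rewrite !mxE => ->; rewrite scale0r.
Qed.

End Spanning.

(** * The twist by conjugation *)

Section PairProducts.
Variables (T : eqType) (R : comPzRingType).
Implicit Types (f : T -> T -> R) (s t : seq T).

Fixpoint pair_prod f s : R :=
  if s is x :: s' then (\prod_(y <- s') f x y) * pair_prod f s' else 1.

Lemma pair_prod_cat f s t :
  pair_prod f (s ++ t) = pair_prod f s * (\prod_(x <- s) \prod_(y <- t) f x y) * pair_prod f t.
Proof.
elim: s => [|x s IHs] /=; first by rewrite big_nil !mul1r.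
by rewrite IHs big_cat big_cons /=; ring.
Qed.

Lemma pair_prod_perm f s t : (forall x y, f x y = f y x) -> perm_eq s t ->
  pair_prod f s = pair_prod f t.
Proof.
move=> fC st; move: s t st.
suff H t0 s : perm_eq s t0 -> pair_prod f s = pair_prod f t0 by move=> s t; apply: H.
elim: t0 s => [|x t IHt] s st; first by rewrite (perm_nilP st).
have /splitPr xs : x \in s by rewrite (perm_mem st) mem_head.
case: xs st => s1 s2; rewrite -cat1s perm_catCA perm_cons => st.
rewrite /= -(IHt _ st) -(perm_big _ st) !pair_prod_cat big_cat /=.
under eq_bigr do rewrite big_cons.
rewrite big_split /= (eq_bigr (f x)) => [|y _]; last exact: fC.
by ring.
Qed.

Lemma pair_prod_map (f g : T -> T -> R) (h : T -> T) s :
  pair_prod f s * pair_prod g (map h s) = pair_prod (fun x y => f x y * g (h x) (h y)) s.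
Proof.
elim: s => [|x s IHs] /=; first by rewrite mulr1.
by rewrite -IHs big_map big_split /=; ring.
Qed.

End PairProducts.

Section Squares.
Variable F : fieldType.

Definition is_square (x : F) := exists r, r ^+ 2 = x.

Lemma is_square_sqr x : is_square (x ^+ 2). Proof. by exists x. Qed.

Lemma is_square1 : is_square 1. Proof. by exists 1; rewrite expr1n. Qed.

Lemma is_squareM x y : is_square x -> is_square y -> is_square (x * y).
Proof. by move=> [r <-] [s <-]; exists (r * s); rewrite exprMn. Qed.

Lemma is_square_prod (T : eqType) (s : seq T) (f : T -> F) :
  {in s, forall x, is_square (f x)} -> is_square (\prod_(x <- s) f x).
Proof.
move=> sq; rewrite big_seq; apply: big_ind => //; first exact: is_square1.
exact: is_squareM.
Qed.

Lemma is_square_pair_prod (T : eqType) (s : seq T) (f : T -> T -> F) :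
  {in s &, forall x y, is_square (f x y)} -> is_square (pair_prod f s).
Proof.
elim: s => [|x s IHs] sq /=; first exact: is_square1.
apply: is_squareM; last by apply: IHs => y z ys zs; apply: sq; rewrite inE ?ys ?zs orbT.
by apply: is_square_prod => y ys; apply: sq; rewrite inE ?eqxx // ys orbT.
Qed.

End Squares.

Section Twist.
Variables (F : fieldType) (q : F) (n : nat).
Hypothesis q_neq0 : q != 0.
Hypothesis qint_neq0 : forall k : nat, (1 <= k <= n)%N -> qint q k != 0.

Local Notation off_num := (off_num q).
Local Notation qintz := (qintz q).
Local Notation tableau := (tableau n).

(* The scaling [weight] makes conjugation of tableaux intertwine T_i with its
   image under #: exchanging adjacent boxes of contents x, y must multiply it by
   [off_num y x / off_num x y]. *)
Definition pair_weight (x y : int) : F := if (`|x - y| <= 1)%N then 1 else off_num x y.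

Definition weight := pair_prod pair_weight.

Definition pair_norm (x y : int) : F := pair_weight x y * pair_weight (- x) (- y).

Lemma pair_normE x y :
  pair_norm x y = if (`|x - y| <= 1)%N then 1
                  else (q^-1) ^+ 2 * (qintz (1 + (y - x)) * qintz (1 - (y - x))).
Proof.
rewrite /pair_norm /pair_weight.
have -> : `|- x - - y|%N = `|x - y|%N by lia.
case: ifP => _; rewrite ?mulr1 // !snumE //.
have -> : - y + 1 - - x = 1 - (y - x) by lia.
have -> : y + 1 - x = 1 + (y - x) by lia.
have := exprzNM q_neq0 x; set a := _ ^ (- x); set b := _ ^ x => ab1.
transitivity (q^-1 ^+ 2 * (qintz (1 + (y - x)) * qintz (1 - (y - x))) * (a * b)).
  by ring.
by rewrite ab1 mulr1.
Qed.

(** [pair_weight] is not symmetric and [weight] depends on the tableau; this symmetry makes [norm]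
    depend on the shape only. *)
Lemma pair_normC x y : pair_norm x y = pair_norm y x.
Proof.
rewrite !pair_normE; have -> : `|y - x|%N = `|x - y|%N by lia.
have -> : 1 + (x - y) = 1 - (y - x) by lia.
have -> : 1 - (x - y) = 1 + (y - x) by lia.
by rewrite (mulrC (qintz (1 + _))).
Qed.

Lemma pair_normN x y : pair_norm (- x) (- y) = pair_norm x y.
Proof. by rewrite /pair_norm !opprK mulrC. Qed.

(** The scalar J^2 for the unnormalised J, phi |-> (w |-> weight w * phi (conj_word w)). *)
Definition norm (w : seq int) := weight w * weight (conj_word w).

Lemma normE w : norm w = pair_prod pair_norm w.
Proof. exact: pair_prod_map. Qed.

Lemma norm_perm w w' : perm_eq w w' -> norm w = norm w'.
Proof. by rewrite !normE; apply: pair_prod_perm pair_normC. Qed.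

Lemma conj_tableau w : tableau w -> tableau (conj_word w).
Proof. by case/andP => w_std sw; rewrite /tableau std_conj // size_map. Qed.

Lemma weight_neq0 w : tableau w -> weight w != 0.
Proof.
case/andP => w_std /eqP sw.
have : {in w &, forall x y, (`|(x - y)%R| < n)%N}.
  by move=> x y xw yw; rewrite -sw std_content_dist.
rewrite /weight; elim: (w) => [|x s IHs] dist /=; first exact: oner_neq0.
rewrite mulf_neq0 ?IHs //; last by move=> y z ys zs; apply: dist; rewrite inE ?ys ?zs orbT.
rewrite big_seq; apply: (big_ind (fun a : F => a != 0)); first exact: oner_neq0.
  by move=> a b; apply: mulf_neq0.
move=> y ys; rewrite /pair_weight; case: ifP => [_|]; first exact: oner_neq0.
move/negbT; rewrite -ltnNge => far; apply: (off_num_neq0 q_neq0 qint_neq0).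
by rewrite far dist // inE ?eqxx // ys orbT.
Qed.

Lemma norm_neq0 w : tableau w -> norm w != 0.
Proof. by move=> w_tab; rewrite mulf_neq0 ?weight_neq0 // conj_tableau. Qed.

Lemma weight_swap i w : (i.+1 < size w)%N ->
  weight (swap i w) * pair_weight (ct w i) (ct w i.+1) =
  weight w * pair_weight (ct w i.+1) (ct w i).
Proof.
elim: i w => [|i IHi] [|x w] //=.
  by case: w => [|y w] // _; rewrite /weight /= !big_cons; ring.
rewrite ltnS => iw; rewrite /weight /= -!mulrA -/(weight _) (IHi _ iw).
by rewrite (perm_big _ (perm_swap i w)).
Qed.

Section SelfConjugate.
Hypothesis sqrtN1 : exists r : F, r ^+ 2 = -1.
Hypothesis sqrt_qint : forall m : nat, (2 * m <= n - 1)%N ->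
  exists r : F, r ^+ 2 = qint q (2 * m + 1).

(** For negative arguments, [-k] = -q^{-2k}[k] is a square because -1 is one. *)
Lemma qintz_square (m : int) : (`|(2 * m + 1)%R| <= n)%N -> is_square (qintz (2 * m + 1)).
Proof.
have pos (k : nat) : (2 * k + 1 <= n)%N -> is_square (qint q (2 * k + 1)).
  by move=> kn; apply: sqrt_qint; lia.
case: m => k kn.
  have -> : 2 * Posz k + 1 = Posz (2 * k + 1) by lia.
  by apply: pos; lia.
have -> : 2 * Negz k + 1 = - Posz (2 * k + 1) by lia.
rewrite qintzN // -mulN1r -mulrA; apply: is_squareM => //; apply: is_squareM.
  by exists (q ^ (- Posz (2 * k + 1))); exact: (exprzAC q _ 2).
by apply: pos; lia.
Qed.

Lemma pair_norm_square x y (m : int) : y - x = 2 * m -> (`|x - y| < n)%N ->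
  is_square (pair_norm x y).
Proof.
move=> xy dist; rewrite pair_normE; case: ifP => far; first exact: is_square1.
apply: is_squareM; first exact: is_square_sqr.
rewrite xy; have -> : 1 + 2 * m = 2 * m + 1 by lia.
have -> : 1 - 2 * m = 2 * (- m) + 1 by lia.
by apply: is_squareM; apply: qintz_square; lia.
Qed.

(* Pairs of boxes with even content difference contribute squares, and the
   others are matched with each other by conjugation. *)
Lemma norm_square w : tableau w -> perm_eq w (conj_word w) -> is_square (norm w).
Proof.
case/andP => w_std /eqP sw ww'.
have dist : {in w &, forall x y, (`|(x - y)%R| < n)%N}.
  by move=> x y xw yw; rewrite -sw std_content_dist.
pose ev (x : int) := ~~ odd `|x|.
have evN x : ev (- x) = ev x by rewrite /ev abszN.
have filter_conj (P : pred int) : perm_eq [seq x <- w | P (- x)] (conj_word [seq x <- w | P x]).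
  rewrite (perm_trans (perm_filter _ ww')) // filter_map.
  apply: perm_map; have -> // : filter (preim -%R (fun x => P (- x))) w = filter P w.
  by apply: eq_filter => x /=; rewrite opprK.
pose E := [seq x <- w | ev x].
pose O := [seq x <- w | ~~ ev x].
(* Odd contents are nonzero, so they fall into positive and negative ones, exchanged by
   conjugation. *)
pose P := [seq x <- w | ~~ ev x && (0 < x)].
pose N := [seq x <- w | ~~ ev x && (0 < - x)].
have wEO : perm_eq w (E ++ O) by rewrite perm_sym perm_filterC.
have OPN : perm_eq O (P ++ N).
  rewrite -(perm_filterC (fun x => 0 < x) O) /O -!filter_predI.
  rewrite (eq_filter (a2 := fun x => ~~ ev x && (0 < x))) => [|x]; last first.
    by rewrite /= andbC.
  rewrite perm_cat2l (eq_filter (a2 := fun x => ~~ ev x && (0 < - x))) // => x /=.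
  by rewrite /ev; case: x => [[|k]|k] //=; lia.
have NP : perm_eq N (conj_word P).
  apply: perm_trans (filter_conj (fun x => ~~ ev x && (0 < x))).
  by rewrite /N; under [X in perm_eq _ X]eq_filter => x do rewrite evN.
have EE : perm_eq E (conj_word E).
  apply: perm_trans (filter_conj ev).
  by under [X in perm_eq _ X]eq_filter => x do rewrite evN.
have sub (p : pred int) : {subset [seq x <- w | p x] <= w}.
  by move=> x; rewrite mem_filter => /andP[].
rewrite normE (pair_prod_perm pair_normC wEO) pair_prod_cat.
have same_parity (p : pred int) : (forall x y, p x -> p y -> exists m, y - x = 2 * m) ->
    is_square (pair_prod pair_norm [seq x <- w | p x]).
  move=> pP; apply: is_square_pair_prod => x y.
  rewrite !mem_filter => /andP[px xw] /andP[py yw].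
  by have [m xy] := pP x y px py; apply: (pair_norm_square xy); apply: dist.
apply: is_squareM; first apply: is_squareM.
- by apply: same_parity => x y ex ey; exists ((y - x) %/ 2)%Z; move: ex ey; rewrite /ev; lia.
(* Negating both entries, which preserves [E] and [pair_norm], carries the product over [E] and [P]
   to that over [E] and [N]; together they form a square. *)
- under eq_bigr => x _ do rewrite (perm_big _ OPN) big_cat (perm_big _ NP) big_map.
  rewrite big_split /= [X in _ * X](perm_big _ EE) big_map.
  under [X in _ * X]eq_bigr => x _ do under eq_bigr do rewrite pair_normN.
  by rewrite -expr2; apply: is_square_sqr.
- by apply: same_parity => x y ex ey; exists ((y - x) %/ 2)%Z; move: ex ey; rewrite /ev; lia.
Qed.

End SelfConjugate.

End Twist.

(** A number determined by the shape, which allows a choice between two conjugate shapes. *)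
Definition code (w : seq int) : nat := pickle (sort <=%R w).

Lemma code_eq w w' : (code w == code w') = perm_eq w w'.
Proof.
rewrite /code (inj_eq (pcan_inj pickleK)).
by apply/eqP/idP => [/perm_sort_leP|/perm_sort_leP].
Qed.

Lemma perm_conj (w w' : seq int) : perm_eq (conj_word w) (conj_word w') = perm_eq w w'.
Proof.
apply/idP/idP => [|/perm_map]; last exact.
by move/(perm_map -%R); rewrite !conj_wordK.
Qed.

Lemma perm_conjC (w w' : seq int) : perm_eq (conj_word w) w' = perm_eq w (conj_word w').
Proof. by rewrite -perm_conj conj_wordK. Qed.

(** * The twist as an involution, and its relation to the automorphism # *)

Section NormalisedTwist.
Variables (F : fieldType) (q : F) (n : nat).
Hypothesis q_neq0 : q != 0.
Hypothesis qint_neq0 : forall k : nat, (1 <= k <= n)%N -> qint q k != 0.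
Local Notation tableau := (tableau n).
Local Notation hecke := (hecke q n).
Local Notation norm := (norm q).
Local Notation weight := (weight q).
Local Notation pair_weight := (pair_weight q).

(** The first condition is the one satisfied by [weight], and it survives rescaling on each shape;
    the second says that J^2 = 1 for the J defined by [g]. *)
Definition is_twist (g : seq int -> F) :=
  (forall w i, tableau w -> (i.+1 < n)%N ->
    g (swap i w) * pair_weight (ct w i) (ct w i.+1) =
    g w * pair_weight (ct w i.+1) (ct w i)) /\
  (forall w, tableau w -> g w * g (conj_word w) = 1).

Lemma twist_exists :
  (exists r : F, r ^+ 2 = -1) ->
  (forall m : nat, (2 * m <= n - 1)%N -> exists r : F, r ^+ 2 = qint q (2 * m + 1)) ->
  exists g, is_twist g.
Proof.
move=> sqrtN1 sqrt_qint.
have root_ex (x : F) : exists r : F, is_square x -> r ^+ 2 = x.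
  by have [[r rx]|nsq] := pselect (is_square x); [exists r|exists 0].
have [root rootP] := boolp.choice root_ex.
(* [nu] rescales the twist on each shape so that its square is 1; the choice is
   free unless the shape is self-conjugate, where it takes a square root. *)
pose nu w := if perm_eq w (conj_word w) then (root (norm w))^-1
  else if (code w < code (conj_word w))%N then 1 else (norm w)^-1.
have norm_conj w : norm (conj_word w) = norm w by rewrite /norm conj_wordK mulrC.
have nu_perm w w' : perm_eq w w' -> nu w = nu w'.
  move=> ww'; have cww' : perm_eq (conj_word w) (conj_word w') by rewrite perm_conj.
  rewrite /nu (norm_perm q_neq0 ww') (permPl ww') (permPr cww').
  have /eqP -> : code w == code w' by rewrite code_eq.
  by have /eqP -> : code (conj_word w) == code (conj_word w') by rewrite code_eq.
exists (fun w => nu w * weight w); split=> [w i /andP[_ /eqP sw] i_n|w w_tab].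
  by rewrite (nu_perm _ _ (perm_swap i w)) -!mulrA weight_swap // sw.
transitivity (nu w * nu (conj_word w) * norm w); first by rewrite /norm; ring.
have norm0 := norm_neq0 q_neq0 qint_neq0 w_tab.
rewrite /nu !norm_conj !conj_wordK (perm_sym (conj_word w)); case: ifP => ww'.
  have r2 := rootP _ (norm_square q_neq0 sqrtN1 sqrt_qint w_tab ww').
  have r0 : root (norm w) != 0 by apply: contraNneq norm0 => r0; rewrite -r2 r0 expr0n.
  by rewrite -[X in _ * X = _]r2; field.
have : code w != code (conj_word w) by rewrite code_eq ww'.
by case: ltngtP => // _ _; rewrite ?mul1r ?mulr1 mulVf.
Qed.

Lemma hTVE (i : 'I_n.-1) : (hT q i)^-1 = hT q i - (q - q^-1) *: 1.
Proof.
have E1 : hT q i * (hT q i - (q - q^-1) *: 1) = 1.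
  by rewrite mulrBr hT_quad // -scalerAr mulr1 addrK.
have E2 : (hT q i - (q - q^-1) *: 1) * hT q i = 1.
  by rewrite mulrBl hT_quad // -scalerAl mul1r addrK.
have u : hT q i \is a GRing.unit by apply/unitrP; exists (hT q i - (q - q^-1) *: 1).
by apply: (mulrI u); rewrite mulrV // E1.
Qed.

Lemma adj_neq1 (i : 'I_n.-1) : adj i != 1%g.
Proof.
apply/eqP => /permP/(_ (Ordinal (adj_lt0 i))); rewrite tpermL perm1 => /(congr1 val) /=.
by lia.
Qed.

Lemma coxeter_length_adj (i : 'I_n.-1) : coxeter_length (adj i) = 1%N.
Proof.
rewrite /coxeter_length; case: ex_minnP => m /existsP[s /eqP sE] min.
have : (m <= 1)%N.
  by apply: min; apply/existsP; exists [tuple i]; rewrite /word_perm big_seq1.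
case: m s sE min => [|[|m]] // s sE _ _.
by have := adj_neq1 i; rewrite -sE tuple0 /word_perm big_nil eqxx.
Qed.

Lemma adj_inj : injective (@adj n).
Proof.
move=> i j /permP E; apply: val_inj.
have /(congr1 val) := E (Ordinal (adj_lt0 i)); have /(congr1 val) := E (Ordinal (adj_lt1 i)).
rewrite /adj tpermL tpermR /=.
by do 2 case: tpermP => [/(congr1 val)|/(congr1 val)|/eqP + /eqP] /=; rewrite -?val_eqE /=; lia.
Qed.

(** The reduced word in [hTw] is an arbitrary choice; length one and injectivity of [adj] leave only
    the word i. *)
Lemma hTw_adj (i : 'I_n.-1) : hTw q (adj i) = hT q i.
Proof.
rewrite /hTw; have /andP[/eqP red /eqP wE] := xchooseP (reduced_wordP (adj i)).
rewrite -/(reduced_word (adj i)) in red wE.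
move: red; rewrite wE coxeter_length_adj.
case: (reduced_word _) wE => [|j [|]] //; rewrite /word_perm big_seq1 => /adj_inj -> _.
by rewrite big_seq1.
Qed.

Section Hash.
Variable hash : {lrmorphism hecke -> hecke}.
Hypothesis hashP : is_hash hash.

Lemma hash_hT i : hash (hT q i) = (q - q^-1) *: 1 - hT q i.
Proof.
have [_ /(_ (adj i))] := hashP; rewrite coxeter_length_adj hTw_adj => ->.
have -> : ((adj i)^-1 = adj i)%g by apply: tpermV.
by rewrite hTw_adj hTVE expr1 mulN1r opprB.
Qed.

Variable g : seq int -> F.
Hypothesis gP : is_twist g.

Definition twist (phi : seq int -> F) (w : seq int) := g w * phi (conj_word w).

Lemma ct_conj w i : ct (conj_word w) i = - ct w i.
Proof.
have [i_lt|i_ge] := ltnP i (size w); first by rewrite (nth_map 0).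
by rewrite !nth_default ?oppr0 // size_map.
Qed.

(** The relation #(T_i) J = J T_i. Diagonal terms agree by [diag_coef_sym] and [diag_coef_opp],
    exchange terms by the first condition on [g] after cancelling [off_num x y], nonzero for
    contents at distance at least 2. *)
Lemma twist_Tact i phi w : tableau w -> (i.+1 < n)%N ->
  (q - q^-1) * twist phi w - Tact q i (twist phi) w = twist (Tact q i phi) w.
Proof.
move=> w_tab i_n; have xy := tableau_ct_neq q_neq0 qint_neq0 w_tab i_n.
rewrite /twist /Tact -swap_map !ct_conj; have [g_swap _] := gP.
move: xy (g_swap _ _ w_tab i_n); set x := ct w i; set y := ct w i.+1 => xy gE.
rewrite diag_coef_opp // -(diag_coef_sym q_neq0 xy).
have E : - off_coef q x y * g (swap i w) = g w * off_coef q (- x) (- y).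
  have := off_num_off_coef_opp q_neq0 xy; move: gE; rewrite /pair_weight /off_coef.
  have -> : `|y - x|%N = `|x - y|%N by lia.
  have -> : `|- x - - y|%N = `|x - y|%N by lia.
  case: ifP => [_ _ _|/negbT]; first by rewrite oppr0 mul0r mulr0.
  rewrite -ltnNge => far gE sE.
  have s0 : off_num q x y != 0.
    apply: (off_num_neq0 q_neq0 qint_neq0); rewrite far.
    case/andP: w_tab => w_std /eqP sw; rewrite -sw std_content_dist // mem_nth // sw //.
    exact: ltnW.
  apply: (mulIf s0); rewrite -mulrA gE mulrCA sE; ring.
set a := phi _; set b := phi _.
transitivity (g w * (diag_coef q y x * a) + (- off_coef q x y * g (swap i w)) * b); first by ring.
by rewrite E; ring.
Qed.

Lemma haction_twist a phi w : tableau w ->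
  haction (hash a) (twist phi) w = twist (haction a phi) w.
Proof.
have twist_ext f f' u : (forall v, tableau v -> f v = f' v) -> tableau u ->
    twist f u = twist f' u.
  by move=> ff' u_tab; rewrite /twist ff' // conj_tableau.
elim/hclass_ind: a => x w_tab.
rewrite (twist_ext _ (hact q x phi)) // => [|v v_tab]; last first.
  exact: (haction_class q_neq0 qint_neq0).
elim: x phi w w_tab => [c|i|x IHx y IHy|x IHx y IHy] phi w w_tab /=.
- rewrite hclass_cst linearZ rmorph1 /= (hactionZ q_neq0 qint_neq0) //.
  by rewrite (haction1 q_neq0 qint_neq0) // /twist mulrCA.
- rewrite -/(hT q i) hash_hT (hactionB q_neq0 qint_neq0) // (hactionZ q_neq0 qint_neq0) //.
  rewrite (haction1 q_neq0 qint_neq0) // (haction_hT q_neq0 qint_neq0) //.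
  by rewrite twist_Tact // gen_lt.
- rewrite -hclassD rmorphD /= (hactionD q_neq0 qint_neq0) // IHx // IHy //.
  by rewrite /twist mulrDr.
- rewrite -hclassM rmorphM /= (hactionM q_neq0 qint_neq0) // -IHx //.
  by apply: (haction_ext (n := n)) => // u u_tab; rewrite IHy.
Qed.

Lemma twist_neq0 w : tableau w -> g w != 0.
Proof.
move=> w_tab; apply/eqP => g0; have [_ /(_ w w_tab) /eqP] := gP.
by rewrite g0 mul0r eq_sym oner_eq0.
Qed.

Lemma mcoef_hash a s t : tableau s ->
  mcoef (hash a) s t * g t = g s * mcoef a (conj_word s) (conj_word t).
Proof.
move=> s_tab; have := haction_twist a (fun w => (w == conj_word t)%:R) s_tab.
rewrite [RHS]/twist -/(mcoef _ _ _) => <-.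
transitivity (haction (hash a) (fun w => g t * (w == t)%:R) s).
  by rewrite mulrC /haction hactZ.
rewrite /haction; apply: hact_eq => w; rewrite /twist.
rewrite (inj_eq (inj_map oppr_inj)).
by case: eqVneq => [->|]; rewrite ?mulr0.
Qed.

End Hash.
End NormalisedTwist.

(** * The alternating Hecke algebra *)

(** Minimum and maximum encode an unordered pair, here the codes of a shape and its conjugate; as
    conjugation is an involution, one coincidence forces the other. *)
Lemma minmax_eq (k k' l l' : nat) : (k = l -> k' = l') -> (k = l' -> k' = l) ->
  (minn k k' == minn l l') && (maxn k k' == maxn l l') = (k == l) || (k == l').
Proof.
move=> E E'; case: (k =P l) => [kl|kl]; first by rewrite (E kl) kl !eqxx.
case: (k =P l') => [kl'|kl']; first by rewrite (E' kl') kl' minnC maxnC !eqxx.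
by apply/negP => /andP[/eqP + /eqP]; lia.
Qed.

Section AlternatingCoefficients.
Variables (F : fieldType) (q : F) (n : nat).
Hypothesis n_gt1 : (1 < n)%N.
Hypothesis char_neq2 : 2%N \notin [pchar F].
Hypothesis q_neq0 : q != 0.
Hypothesis qint_neq0 : forall k : nat, (1 <= k <= n)%N -> qint q k != 0.
Variable hash : {lrmorphism hecke q n -> hecke q n}.
Hypothesis hashP : is_hash hash.
Variable g : seq int -> F.
Hypothesis gP : is_twist q n g.

Local Notation tableau := (tableau n).
Local Notation B := (alternating_hecke hash).
Local Notation mcoef_hash := (mcoef_hash q_neq0 qint_neq0 hashP gP).

(** Index 1 is box 2, of content 1 or -1; so this takes one tableau from each conjugate pair, also
    within a self-conjugate shape. *)
Definition half_stds := [seq s <- stds n | ct s 1 == 1].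

Definition self_conj (s : seq int) := perm_eq s (conj_word s).

Lemma mem_half s : (s \in half_stds) = tableau s && (ct s 1 == 1).
Proof. by rewrite mem_filter mem_tableaux andbC. Qed.

Lemma half_tableau s : s \in half_stds -> tableau s.
Proof. by rewrite mem_half => /andP[]. Qed.

Lemma conj_half s : tableau s -> (conj_word s \in half_stds) = (s \notin half_stds).
Proof.
move=> s_tab; rewrite !mem_half conj_tableau // s_tab /= ct_conj.
case/andP: s_tab => s_std /eqP sn; have s_gt1 : (1 < size s)%N by rewrite sn.
by have [->|->] := std_nth1 s_std s_gt1; rewrite ?opprK.
Qed.

Lemma half_neq_conj s t : s \in half_stds -> t \in half_stds -> (s == conj_word t) = false.
Proof.
move=> sh th; apply/eqP => E; move: sh.
by rewrite E conj_half ?th // half_tableau.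
Qed.

Lemma big_half (f : seq int -> F) :
  \sum_(u <- stds n) f u = \sum_(u <- half_stds) (f u + f (conj_word u)).
Proof.
rewrite (bigID (fun u => ct u 1 == 1)) /= big_split /=.
rewrite -[X in X + _ = _]big_filter -[X in _ + X = _]big_filter -/half_stds.
congr (_ + _); rewrite -[RHS](big_map (fun w : seq int => conj_word w) xpredT).
apply/perm_big/uniq_perm.
- by rewrite filter_uniq ?stds_uniq.
- by rewrite map_inj_uniq ?filter_uniq ?stds_uniq //; apply/inj_map/oppr_inj.
move=> s; rewrite mem_filter mem_tableaux; apply/andP/mapP => [[s1 s_tab]|[t]].
  exists (conj_word s); rewrite ?conj_wordK // conj_half // mem_half s_tab /=.
  exact: s1.
move=> th ->; have t_tab := half_tableau th; split; last exact: conj_tableau.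
have := conj_half t_tab; rewrite th /= mem_half conj_tableau //= => /negbT.
by [].
Qed.

Lemma g_mul s : tableau s -> g s * g (conj_word s) = 1.
Proof. by case: gP => _; apply. Qed.

Lemma g_mulC s : tableau s -> g (conj_word s) * g s = 1.
Proof. by move=> s_tab; rewrite mulrC g_mul. Qed.

Lemma mcoef_fixed (b : B) s t : tableau s ->
  mcoef (fixed_val b) s t * g t = g s * mcoef (fixed_val b) (conj_word s) (conj_word t).
Proof.
move=> s_tab; rewrite -mcoef_hash //.
by have /eqP -> : hash (fixed_val b) == fixed_val b by exact: (@fixed_valP _ _ _ b).
Qed.

Definition sgn (e : bool) : F := if e then 1 else -1.

(* A fixed element preserves the functions [phi] with
   [phi (conj_word t) = sgn e * g (conj_word t) * phi t], which are determined by
   their restriction to [half_stds]. *)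
Definition alt_coef (b : B) (x y : seq int * bool) : F :=
  if x.2 == y.2 then
    mcoef (fixed_val b) x.1 y.1 +
    sgn y.2 * g (conj_word y.1) * mcoef (fixed_val b) x.1 (conj_word y.1)
  else 0.

(** The Boolean is the sign of the eigenspace of J. For a shape that is not self-conjugate both
    signs give the same representation of the fixed algebra, so only one is listed. *)
Definition alt_basis : seq (seq int * bool) :=
  [seq (s, e) | s <- half_stds, e <- if self_conj s then [:: true; false] else [:: true]].

(* identifies a shape with its conjugate *)
Definition alt_shape (x : seq int * bool) : nat * nat * bool :=
  let k := code x.1 in let k' := code (conj_word x.1) in (minn k k', maxn k k', x.2).

Lemma mem_alt_basis s e :
  ((s, e) \in alt_basis) = (s \in half_stds) && (e || self_conj s).
Proof.
apply/allpairsPdep/andP => [[s' [e' [s'h e'P [-> ->]]]]|[sh eP]].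
  by split=> //; move: e'P; case: ifP => _; rewrite ?orbT // inE => /eqP ->.
by exists s, e; split=> //; move: eP; case: ifP; case: e.
Qed.

Lemma alt_basis_uniq : uniq alt_basis.
Proof.
apply: allpairs_uniq_dep => [|s _|[s e] [s' e'] _ _ /= [-> ->]//].
  by rewrite filter_uniq ?stds_uniq.
by case: ifP.
Qed.

Lemma big_alt_basis (f : seq int * bool -> F) :
  \sum_(x <- alt_basis) f x =
  \sum_(s <- half_stds) (f (s, true) + if self_conj s then f (s, false) else 0).
Proof.
rewrite big_allpairs_dep; apply: eq_bigr => s _.
by case: ifP => _; rewrite !big_cons big_nil /= !addr0.
Qed.

Lemma alt_shape_eq s t e d : (alt_shape (s, e) == alt_shape (t, d)) =
  (perm_eq s t || perm_eq s (conj_word t)) && (e == d).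
Proof.
rewrite /alt_shape !xpair_eqE /= minmax_eq -?code_eq // => /eqP; rewrite code_eq => st.
  by apply/eqP; rewrite code_eq perm_conj.
by apply/eqP; rewrite code_eq perm_conjC.
Qed.

Lemma self_conj_perm s t : perm_eq s t || perm_eq s (conj_word t) ->
  self_conj s = self_conj t.
Proof.
rewrite /self_conj -!code_eq; have code_conj (u v : seq int) :
    code u = code v -> code (conj_word u) = code (conj_word v).
  by move/eqP; rewrite code_eq -perm_conj -code_eq => /eqP.
case/orP => /eqP E; have := code_conj _ _ E; rewrite E ?conj_wordK => -> //.
Qed.

Lemma mcoef_eq0 (b : B) s t : tableau s -> ~~ perm_eq s t -> mcoef (fixed_val b) s t = 0.
Proof. exact: mcoef_block. Qed.

Lemma alt_coef_linear c (a b : B) x y : x \in alt_basis -> y \in alt_basis ->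
  alt_coef (c *: a + b) x y = c * alt_coef a x y + alt_coef b x y.
Proof.
case: x => s e; rewrite mem_alt_basis => /andP[/half_tableau s_tab _] _.
rewrite /alt_coef; case: ifP => _; last by rewrite mulr0 addr0.
have -> : fixed_val (c *: a + b) = c *: fixed_val a + fixed_val b by [].
by rewrite !(mcoef_linear q_neq0 qint_neq0) //=; ring.
Qed.

Lemma alt_coef1 x y : x \in alt_basis -> y \in alt_basis ->
  alt_coef 1 x y = (x == y)%:R.
Proof.
case: x y => [s e] [t d]; rewrite !mem_alt_basis => /andP[sh _] /andP[th _].
have s_tab := half_tableau sh.
rewrite /alt_coef [fixed_val _](_ : _ = 1) // xpair_eqE [RHS]/= andbC /=.
case: eqP => //= _.
by rewrite !(mcoef1 q_neq0 qint_neq0) // half_neq_conj // mulr0 addr0.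
Qed.

Lemma alt_coefM (a b : B) x y : x \in alt_basis -> y \in alt_basis ->
  alt_coef (a * b) x y = \sum_(u <- alt_basis) alt_coef a x u * alt_coef b u y.
Proof.
case: x y => [s e] [t d]; rewrite !mem_alt_basis => /andP[sh se] /andP[th _].
have [s_tab t_tab] := (half_tableau sh, half_tableau th).
rewrite big_alt_basis /alt_coef /=; case: eqP => [ed|ed]; last first.
  rewrite big1 // => u _; case: (e) (d) ed => [] [] //= _;
    by rewrite !(mul0r, mulr0) add0r; case: ifP.
rewrite !(mcoefM q_neq0 qint_neq0) // mulr_sumr -big_split big_half /=.
apply: eq_big_seq => u uh; have u_tab := half_tableau uh.
rewrite -ed; set ca := mcoef (fixed_val a); set cb := mcoef (fixed_val b).
(* [Eb1] and [Eb2] express the row of b at [conj_word u] by the row at u: b preserves the eigenspace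
   of sign e. *)
have Eb1 : sgn e * g (conj_word t) * cb (conj_word u) (conj_word t) =
    sgn e * g (conj_word u) * cb u t.
  apply: (mulfI (twist_neq0 gP u_tab)); apply: (mulIf (twist_neq0 gP t_tab)).
  transitivity (sgn e * (g u * cb (conj_word u) (conj_word t)) *
    (g (conj_word t) * g t)); first by ring.
  rewrite -/cb -mcoef_fixed // g_mulC // mulr1.
  transitivity (sgn e * (cb u t * g t) * (g u * g (conj_word u))); last by ring.
  by rewrite g_mul ?mulr1.
have Eb2 : cb (conj_word u) t = g (conj_word u) * g (conj_word t) * cb u (conj_word t).
  apply: (mulIf (twist_neq0 gP t_tab)).
  rewrite /cb mcoef_fixed ?conj_tableau // conj_wordK -/cb.
  transitivity (g (conj_word u) * cb u (conj_word t) * (g (conj_word t) * g t)); last by ring.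
  by rewrite g_mulC ?mulr1.
have sgn2 : sgn e * sgn e = 1 by case: (e); rewrite /= ?mulr1 ?mulrNN ?mulr1.
transitivity ((ca s u + sgn e * g (conj_word u) * ca s (conj_word u)) *
              (cb u t + sgn e * g (conj_word t) * cb u (conj_word t))).
  transitivity (ca s u * (cb u t + sgn e * g (conj_word t) * cb u (conj_word t)) +
    ca s (conj_word u) * (cb (conj_word u) t +
      sgn e * g (conj_word t) * cb (conj_word u) (conj_word t))); first by ring.
  rewrite Eb1 Eb2.
  transitivity (ca s u * (cb u t + sgn e * g (conj_word t) * cb u (conj_word t)) +
    ca s (conj_word u) * (sgn e * g (conj_word u) * cb u t +
      sgn e * sgn e * (g (conj_word u) * g (conj_word t) * cb u (conj_word t)))); last by ring.
  by rewrite sgn2; ring.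
(* With sign -1 only self-conjugate u are listed. Then s is self-conjugate too, so any other u has a
   different shape and its term vanishes. *)
case: (e) se => /= se; first by case: ifP; rewrite ?mul0r ?mulr0 addr0.
rewrite mul0r add0r; case: ifP => // uN.
have nsu : ~~ (perm_eq s u || perm_eq s (conj_word u)).
  by apply: contraFN uN => /self_conj_perm <-.
move: nsu; rewrite negb_or => /andP[su su'].
by rewrite /ca !mcoef_eq0 // mulr0 add0r mul0r.
Qed.

Lemma alt_coef_block (b : B) x y : x \in alt_basis -> y \in alt_basis ->
  alt_shape x != alt_shape y -> alt_coef b x y = 0.
Proof.
case: x y => [s e] [t d]; rewrite !mem_alt_basis => /andP[/half_tableau s_tab _] _.
rewrite alt_shape_eq negb_and negb_or /alt_coef /=; case: eqP => //= _.
by rewrite orbF => /andP[st st']; rewrite !mcoef_eq0 // mulr0 addr0.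
Qed.

Lemma two_neq0 : (2 : F) != 0.
Proof. by apply: contraNneq char_neq2 => E; rewrite inE /= E eqxx. Qed.

(** By [mcoef_fixed] only rows in [half_stds] matter. On a self-conjugate shape the two signs give u
    + g'v = u - g'v = 0, so u = v = 0 outside characteristic 2; on any other, at most one of t and
    its conjugate has the shape of s. *)
Lemma alt_coef_inj (b : B) :
  {in alt_basis &, forall x y, alt_coef b x y = 0} -> b = 0.
Proof.
move=> b0; apply: val_inj => /=; apply: (mcoef_inj q_neq0 qint_neq0).
have half0 s t : s \in half_stds -> t \in half_stds ->
    mcoef (fixed_val b) s t = 0 /\ mcoef (fixed_val b) s (conj_word t) = 0.
  move=> sh th; have [s_tab t_tab] := (half_tableau sh, half_tableau th).
  have := b0 (s, true) (t, true); rewrite !mem_alt_basis sh th /alt_coef /= mul1r.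
  move=> /(_ isT isT); set g' := g _; have g'0 : g' != 0.
    by apply: (twist_neq0 gP); apply: conj_tableau.
  have [st|st] := boolP (perm_eq s t || perm_eq s (conj_word t)); last first.
    by move: st; rewrite negb_or => /andP[st st'] _; rewrite !mcoef_eq0.
  have [ss|ss] := boolP (self_conj s).
    have ts : self_conj t by rewrite -(self_conj_perm st).
    have := b0 (s, false) (t, false); rewrite !mem_alt_basis sh th ss ts /alt_coef /= -/g'.
    move=> /(_ isT isT); set u := mcoef _ s t; set v := mcoef _ s _ => E1 E2.
    have u0 : u = 0.
      apply: (mulfI two_neq0); rewrite mulr0.
      transitivity ((u + g' * v) + (u + -1 * g' * v)); first by ring.
      by rewrite E1 E2 addr0.
    by split=> //; apply: (mulfI g'0); rewrite mulr0; move: E2; rewrite u0 add0r.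
  have [st1|st1] := boolP (perm_eq s t).
    have st2 : ~~ perm_eq s (conj_word t).
      apply/negP => st2; case/negP: ss; rewrite /self_conj.
      by rewrite (perm_trans st2) // perm_conj perm_sym.
    by rewrite (mcoef_eq0 b s_tab st2) mulr0 addr0.
  rewrite (mcoef_eq0 b s_tab st1) add0r => /eqP.
  by rewrite mulf_eq0 (negPf g'0) /= => /eqP.
move=> s t s_tab t_tab.
have [sh|sh] := boolP (s \in half_stds); have [th|th] := boolP (t \in half_stds).
- by have [] := half0 _ _ sh th.
- have [|_] := half0 s (conj_word t) sh; first by rewrite conj_half.
  by rewrite conj_wordK.
- apply: (mulIf (twist_neq0 gP t_tab)); rewrite mcoef_fixed // mul0r.
  by have [|_ ->] := half0 (conj_word s) t _ th; rewrite ?conj_half ?mulr0.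
apply: (mulIf (twist_neq0 gP t_tab)); rewrite mcoef_fixed // mul0r.
by have [||-> _] := half0 (conj_word s) (conj_word t); rewrite ?conj_half ?mulr0.
Qed.

Lemma alt_coef_surj (M : seq int * bool -> seq int * bool -> F) :
  {in alt_basis &, forall x y, alt_shape x != alt_shape y -> M x y = 0} ->
  exists b : B, {in alt_basis &, forall x y, alt_coef b x y = M x y}.
Proof.
move=> M0.
pose P s t := M (s, true) (t, true); pose Q s t := M (s, false) (t, false).
(* [A] and [C] solve A + g(t')C = P and A - g(t')C = Q, with t' the conjugate of t and 1/g(t') =
   g(t). *)
pose A s t := if perm_eq s t then if self_conj s then (P s t + Q s t) / 2 else P s t else 0.
pose C s t := (if perm_eq s (conj_word t) then
  if self_conj s then (P s t - Q s t) / 2 else P s t else 0) * g t.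
(* The rows outside [half_stds] are those imposed by invariance under #, with g(t') in place of
   1/g(t). *)
pose N s t := if s \in half_stds then
    if t \in half_stds then A s t else C s (conj_word t)
  else g s * (if t \in half_stds then C (conj_word s) t
              else A (conj_word s) (conj_word t)) * g (conj_word t).
have N_block s t : tableau s -> tableau t -> ~~ perm_eq s t -> N s t = 0.
  move=> _ _ /negPf st; rewrite /N /A /C conj_wordK !perm_conj st.
  by do 2 case: ifP => _; rewrite ?mul0r ?mulr0 ?mul0r.
have N_twist s t : tableau s -> tableau t ->
    N s t * g t = g s * N (conj_word s) (conj_word t).
  move=> s_tab t_tab; rewrite /N !conj_half // !conj_wordK.
  have [gs gt] := (g_mul s_tab, g_mul t_tab).
  case: (s \in half_stds); case: (t \in half_stds) => /=.
  - by rewrite !mulrA gs mul1r.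
  - by rewrite !mulrA gs mul1r.
  - by rewrite -mulrA g_mulC ?mulr1.
  - by rewrite -mulrA g_mulC ?mulr1.
have [a aN] := mcoef_surj q_neq0 qint_neq0 N_block.
have a_fixed : a \in fixed_pred hash.
  rewrite -topredE /= /fixed_pred -subr_eq0.
  apply/eqP/(mcoef_inj q_neq0 qint_neq0) => s t s_tab t_tab.
  rewrite -scaleN1r addrC (mcoef_linear q_neq0 qint_neq0) // mulN1r.
  apply/eqP; rewrite addrC subr_eq0; apply/eqP; apply: (mulIf (twist_neq0 gP t_tab)).
  by rewrite mcoef_hash // !aN ?conj_tableau // N_twist.
exists (FixedSubalg a_fixed) => -[s e] [t d].
rewrite !mem_alt_basis => /andP[sh se] /andP[th td].
have [s_tab t_tab] := (half_tableau sh, half_tableau th).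
have [shape|shape] := eqVneq (alt_shape (s, e)) (alt_shape (t, d)); last first.
  by rewrite M0 ?alt_coef_block ?mem_alt_basis ?sh ?th.
move/eqP: shape; rewrite alt_shape_eq => /andP[st /eqP ed]; rewrite -{d}ed in td *.
rewrite /alt_coef /= eqxx !aN ?conj_tableau // /N sh conj_half // th /= conj_wordK /A /C.
have -> : forall c, sgn e * g (conj_word t) * (c * g t) = sgn e * c.
  by move=> c; rewrite -mulrA [g _ * _]mulrCA g_mulC // mulr1.
have [ss|ss] := boolP (self_conj s).
  have tt : perm_eq t (conj_word t) by rewrite -/(self_conj t) -(self_conj_perm st).
  have [-> ->] : perm_eq s t /\ perm_eq s (conj_word t).
    by case/orP: st => st; split=> //; rewrite (perm_trans st) // perm_sym.
  have two := two_neq0.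
  by case: (e); rewrite /P /Q /=; field.
have eT : e = true by move: se; rewrite (negPf ss) orbF.
rewrite eT /= mul1r -/(P s t).
case: (boolP (perm_eq s t)) st => [st _|_ /= ->]; last by rewrite add0r.
case: ifP => [st'|_]; last by rewrite addr0.
by case/negP: ss; rewrite /self_conj (perm_trans st') // perm_conj perm_sym.
Qed.

Lemma alternating_split : split_semisimple B.
Proof.
apply: (@split_semisimple_of_coefs F B _ _ alt_basis alt_shape alt_coef).
- exact: alt_basis_uniq.
- by move=> *; apply: alt_coef_linear.
- exact: alt_coef1.
- exact: alt_coefM.
- exact: alt_coef_block.
- exact: alt_coef_inj.
- exact: alt_coef_surj.
Qed.

End AlternatingCoefficients.

(** With a single box there is no box 2 to halve the tableaux by. There are no generators either, so
    the algebra consists of the scalars, which every morphism fixes. *)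
Lemma alternating_split1 (F : fieldType) (q : F)
    (hash : {lrmorphism hecke q 1 -> hecke q 1}) :
  split_semisimple (alternating_hecke hash).
Proof.
have scalar (a : hecke q 1) : exists c, a = c *: 1.
  elim/hclass_ind: a; elim=> [c|[]//|x [c xE] y [d yE]|x [c xE] y [d yE]].
  - by exists c; apply: hclass_cst.
  - by exists (c + d); rewrite -hclassD xE yE scalerDl.
  - by exists (c * d); rewrite -hclassM xE yE -scalerAl mul1r scalerA.
have cE (c : F) : c *: (1 : hecke q 1) = 0 -> c = 0.
  by move=> /eqP; rewrite scaler_eq0 oner_eq0 orbF => /eqP.
have [f fE] := boolp.choice scalar.
have f_uniq a c : a = c *: 1 -> f a = c.
  move=> ac; apply/eqP; rewrite -subr_eq0; apply/eqP/cE.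
  by rewrite scalerBl -fE ac subrr.
apply: (@split_semisimple_of_coefs F (alternating_hecke hash) unit unit [:: tt]
   id (fun b _ _ => f (fixed_val b))) => //.
- move=> c a b [] [] _ _; apply: f_uniq; rewrite scalerDl -fE -scalerA -fE //.
- by move=> [] [] _ _; apply: f_uniq; rewrite scale1r.
- move=> a b [] [] _ _; rewrite big_seq1; apply: f_uniq.
  transitivity (fixed_val a * fixed_val b) => //.
  by rewrite {1}(fE (fixed_val a)) {1}(fE (fixed_val b)) -scalerAl mul1r scalerA.
- by move=> b /(_ tt tt) b0; apply: val_inj; rewrite /= (fE (fixed_val b)) b0 ?scale0r ?mem_head.
move=> M _; exists (M tt tt *: 1) => -[] [] _ _.
by apply: f_uniq.
Qed.

Theorem corollary6p13 (n : nat) (n_ge1 : (1 <= n)%N)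
    (F : fieldType) (char_neq2 : 2%N \notin [pchar F])
    (q : F) (q_neq0 : q != 0)
    (qint_neq0 : forall k : nat, (1 <= k <= n)%N -> qint q k != 0)
    (sqrtN1 : exists r : F, r ^+ 2 = -1)
    (sqrt_qint : forall m : nat, (2 * m <= n - 1)%N ->
       exists r : F, r ^+ 2 = qint q (2 * m + 1))
    (hash : {lrmorphism hecke q n -> hecke q n}) (hashP : is_hash hash) :
  split_semisimple (alternating_hecke hash).
Proof.
have [n_gt1|n_le1] := ltnP 1 n; last first.
  have n1 : n = 1%N by apply/eqP; rewrite eqn_leq n_le1.
  by move: hash {hashP}; rewrite n1 => hash; apply: alternating_split1.
have [g gP] := twist_exists q_neq0 qint_neq0 sqrtN1 sqrt_qint.
exact: (alternating_split n_gt1 char_neq2 q_neq0 qint_neq0 hashP gP).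
Qed.
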